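(* Let $A,B\in\mathbb{R}^{n\times n}$ and assume that the linear delay-differential equation $\dot x(t)=Ax(t)+Bx(t-\tau)$ is of universality class III, with corresponding frequency $\omega_H>0$ and branch index $j$. Then the characteristic equation $\det[\lambda I-A-Be^{-\lambda\tau}]=0$ has a characteristic root $\lambda_0=0$ for all time delays if and only if $\det(A+B)=0$. Also, the system possesses destabilizing transverse crossings of the characteristic roots with $\lambda_c=\pm i\omega_H$ for the time delays $$\tau_k=\frac{1}{\omega_H}(\phi_H+2\pi k),\quad k=0,1,2,\dots,$$ where $\phi_H=-\arg[Y_j(\omega_H)]$. Moreover, there are no other delay-induced transverse crossings of the characteristic roots.
   Context: The DDE is $\dot x(t)=Ax(t)+Bx(t-\tau)$ with real $n\times n$ matrices $A,B$ and time delay $\tau>0$ regarded as a parameter. Solutions $\lambda$ of the characteristic equation are called characteristic roots. Delay-induced transverse crossing at $\tau=\tau_H$: there is a family of roots $\lambda(\tau)=\alpha(\tau)\pm i\mu(\tau)$ of the characteristic equation with $\alpha(\tau_H)=0$ and $\frac{d\alpha}{d\tau}(\tau_H)\neq0$. It is called stabilizing if $\frac{d\alpha}{d\tau}(\tau_H)<0$ and destabilizing if $\frac{d\alpha}{d\tau}(\tau_H)>0$. Generating polynomial: $p_\omega(Y)=\det[i\omega I-A-BY]$. Asymptotic continuous spectrum (ACS): the collection of curves $\left\{\frac1\tau\gamma_j(\omega)+i\omega\right\}$, $\omega\in\mathbb{R}$, $j=1,\dots,m$, where $\gamma_j(\omega)=-\ln|Y_j(\omega)|$ and $Y_j(\omega)$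 are the roots of the generating polynomial, $p_\omega(Y_j(\omega))=0$. Points $\omega$ for which the polynomial is degenerate, i.e. $p_\omega(Y)\equiv\det[i\omega I-A]$ for all $Y$, are excluded. A branch of the ACS is one of the functions $\gamma_j$. Universality class III: the ACS (and the DDE) is of universality class III if there exist $\omega_H>0$ and $j\in\mathbb{N}$ such that a branch of the ACS satisfies $\gamma_j(0)=0$ and $\gamma_j(\pm\omega_H)=0$, $\gamma_j(\omega)>0$ for all $\omega\in(-\omega_H,0)\cup(0,\omega_H)$, and $\gamma_j(\omega)<0$ for all $\omega\notin[-\omega_H,\omega_H]$; moreover, $\gamma_k(\omega)\neq0$ for all $k\neq j$ and $\omega\in\mathbb{R}$. $\arg$ denotes the principal argument in $(-\pi,\pi]$.
   Formalization: Crossings at ±iω_H are asserted only if γ_j′(ω_H)≠0 (otherwise dα/dτ≠0 fails); crossings are conjugate pairs with nonzero imaginary part, since a real root may pass through 0 when det(A+B)=0; at degenerate ω the class III conditions apply to limit values of the branches. *)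

(* Defs.v *)
(* MathComp-Analysis, with the complex numbers R[i] over R : realType. *)
From HB Require Import structures.
From mathcomp Require Export all_boot all_order all_algebra complex.
From mathcomp Require Export all_classical all_reals all_analysis.
Set Implicit Arguments.
Unset Strict Implicit.
Unset Printing Implicit Defensive.
Import Order.TTheory GRing.Theory Num.Theory.
Import numFieldNormedType.Exports.
Local Open Scope classical_set_scope.
Local Open Scope ring_scope.
Local Open Scope complex_scope.

Local Notation normc := ComplexField.Normc.normc.
Local Notation Re := complex.Re.
Local Notation Im := complex.Im.

(* (R[i])^o is R[i] with the topology of its modulus; None is infinity. *)
Notation csphere R := (one_point_compactification (R[i])^o).

Section dde.
Context {R : realType}.

Definition cexp (z : R[i]) : R[i] :=
  (expR (Re z) * cos (Im z)) +i* (expR (Re z) * sin (Im z)).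

(* Principal argument, in (-pi, pi]; the value at 0 is irrelevant. *)
Definition carg (z : R[i]) : R :=
  if 0 <= Im z then acos (Re z / normc z) else - acos (Re z / normc z).

Lemma cargP (z : R[i]) : z != 0 ->
  (- pi < carg z <= pi) /\ z = (normc z)%:C * cexp (0 +i* carg z).
Proof.
case: z => x y z0; rewrite /carg /=.
set N := Num.sqrt _.
have N2 : N ^+ 2 = x ^+ 2 + y ^+ 2.
  by rewrite /N sqr_sqrtr // addr_ge0 // sqr_ge0.
have Ngt0 : 0 < N.
  rewrite lt_neqAle sqrtr_ge0 andbT; apply: contra z0 => /eqP N0.
  move/eqP: N2; rewrite -N0 expr0n /= eq_sym.
  rewrite paddr_eq0 ?sqr_ge0 // !sqrf_eq0 => /andP[/eqP -> /eqP ->].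
  exact: eqxx.
have q2 : (x / N) ^+ 2 + (y / N) ^+ 2 = 1.
  by rewrite !expr_div_n -mulrDl -N2 divff // expf_neq0 // gt_eqF.
have hq : -1 <= x / N <= 1.
  rewrite -ler_norml -(@expr_le1 _ 2) // real_normK ?num_real //.
  by rewrite -q2 lerDl sqr_ge0.
have hs : sin (acos (x / N)) = `|y| / N.
  rewrite sin_acos // -q2 addrAC subrr add0r sqrtr_sqr normrM.
  by rewrite normfV (gtr0_norm Ngt0).
have Nn : N != 0 by rewrite gt_eqF.
case: ifPn => y0; split.
- rewrite acos_lepi // andbT (lt_le_trans _ (acos_ge0 hq)) //.
  by rewrite oppr_lt0 pi_gt0.
- rewrite /cexp /= expR0 !mul1r acosK ?in_itv //= hs ger0_norm //.
  by apply/eqP; rewrite eq_complex /= !mul0r subr0 addr0 !(mulrC N) !divfK // !eqxx.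
- rewrite -ltNge in y0.
  have ltp : acos (x / N) < pi.
    rewrite lt_neqAle acos_lepi // andbT; apply/eqP => E.
    move: hs; rewrite E sinpi => /esym/eqP.
    by rewrite mulf_eq0 invr_eq0 (negbTE Nn) orbF normr_eq0 lt_eqF.
  rewrite ltrN2 ltp /= (le_trans _ (pi_ge0 R)) //.
  by rewrite oppr_le0 acos_ge0.
- rewrite -ltNge in y0.
  rewrite /cexp /= expR0 !mul1r cosN sinN acosK ?in_itv //= hs ltr0_norm //.
  rewrite mulNr opprK.
  by apply/eqP; rewrite eq_complex /= !mul0r subr0 addr0 !(mulrC N) !divfK // !eqxx.
Qed.

Section system.
Context {n : nat}.
Implicit Types (A B : 'M[R]_n) (tau omega : R).

Definition cmx A : 'M[R[i]]_n := map_mx (real_complex R) A.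

Definition char_root A B tau (lam : R[i]) : Prop :=
  \det (lam%:M - cmx A - cexp (- (lam * tau%:C)) *: cmx B) = 0.

(* p_omega(Y) = det (i omega I - A - B Y), as a polynomial in Y. *)
Definition genpoly A B omega : {poly R[i]} :=
  \det (map_mx polyC ((0 +i* omega)%:M - cmx A) - 'X *: map_mx polyC (cmx B)).

Definition degenerate A B omega : Prop :=
  genpoly A B omega = (\det ((0 +i* omega)%:M - cmx A))%:P.

(* -ln |Y|, with the values +oo at Y = 0 (lne 0 = -oo) and -oo at infinity. *)
Definition gam (z : csphere R) : \bar R :=
  if z is Some y then (- lne (normc y)%:E)%E else (-oo)%E.

Definition root_factor (z : csphere R) : {poly R[i]} :=
  if z is Some y then 'X - (y : R[i])%:P else 1.

(* The m roots of the generating polynomial, listed with multiplicity, as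
   continuous curves omega |-> Y_j(omega) on the Riemann sphere. The degree of
   p_omega can drop at isolated omega, where the missing roots are at infinity.
   Degenerate omega are excluded from the root equation; there Y_j takes its
   limit value. *)
Definition acs_roots A B (m : nat) (Y : 'I_m -> R -> csphere R) : Prop :=
  [/\ exists omega, size (genpoly A B omega) = m.+1,
      forall j, continuous (Y j) &
      forall omega, ~ degenerate A B omega ->
        genpoly A B omega = lead_coef (genpoly A B omega) *:
          \prod_(j < m) root_factor (Y j omega)].

(* lambda(t) = alpha(t) +- i mu(t) is a family of pairs of complex conjugate
   roots that reaches +- i omega, with omega > 0, at t = tauH. A single real
   root passing through 0 is not such a pair. *)
Definition root_family A B tauH omega (alpha mu : R -> R) : Prop :=
  [/\ 0 < omega,
      \forall t \near tauH,
        [/\ char_root A B t (alpha t +i* mu t),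
            char_root A B t (alpha t -i* mu t),
            {for t, continuous alpha} & {for t, continuous mu}],
      alpha tauH = 0, mu tauH = omega & derivable alpha tauH 1].

Definition transverse_crossing A B tauH omega : Prop :=
  exists alpha mu, root_family A B tauH omega alpha mu /\
    derive1 alpha tauH != 0.

Definition destabilizing_crossing A B tauH omega : Prop :=
  exists alpha mu, root_family A B tauH omega alpha mu /\
    0 < derive1 alpha tauH.

End system.

Definition class_III (m : nat) (Y : 'I_m -> R -> csphere R) (j : 'I_m)
    (omegaH : R) : Prop :=
  [/\ 0 < omegaH,
      [/\ gam (Y j 0) = 0%E, gam (Y j omegaH) = 0%E
        & gam (Y j (- omegaH)) = 0%E],
      forall omega, - omegaH < omega < omegaH -> omega != 0 ->
        (0 < gam (Y j omega))%E,
      forall omega, ~~ (- omegaH <= omega <= omegaH) ->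
        (gam (Y j omega) < 0)%E &
      forall k, k != j -> forall omega, gam (Y k omega) <> 0%E].

Definition phi_H (m : nat) (Y : 'I_m -> R -> csphere R) (j : 'I_m)
    (omegaH : R) : R := - oapp carg 0 (Y j omegaH).

Definition tau_ (phi omegaH : R) (k : nat) : R :=
  omegaH^-1 * (phi + 2 * pi * k%:R).

End dde.

(* Main.v *)
(* Near i omega write det (l - A - B y) = (l - i omega)^s q(l, y), with
   q(i omega, .) not zero; the roots of q(i omega, .) are the values
   Y_k(omega), with multiplicity, also at degenerate omega.

   A transverse crossing at (tau, i omega) is a limit of roots l(t) <> i omega,
   so q(i omega, e^(-i omega tau)) = 0. Some branch thus has
   Y_k(omega) = e^(-i omega tau), of modulus 1; class III forces k = j and
   omega = omega_H, and the argument of Y_j(omega_H) determines tau modulo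
   2 pi / omega_H.

   Conversely Y_j(omega_H) is the only root of modulus 1, hence a simple root.
   Put w = q_l / (q_y Y_j). Implicit differentiation gives
   gamma_j'(omega_H) = - Im w, which is negative by the signs of gamma_j.
   So q(l, e^(-l t)) has l-derivative q_y Y_j (w - tau) <> 0, and the implicit
   function theorem gives a root l(t) with l' = i omega_H / (w - tau) and
   Re l' = omega_H Im w / |w - tau|^2 > 0. *)
Require Import Defs.
From mathcomp Require Import lra ring.
Import Order.TTheory GRing.Theory Num.Theory.
Import numFieldNormedType.Exports.
Set Implicit Arguments.
Unset Strict Implicit.
Unset Printing Implicit Defensive.
Local Open Scope classical_set_scope.
Local Open Scope ring_scope.
Local Open Scope complex_scope.

Local Notation normc := ComplexField.Normc.normc.
Local Notation Re := complex.Re.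
Local Notation Im := complex.Im.
Import ComplexField.Normc.

(** * The topology of the complex plane *)

Section ComplexModulus.
Context {R : realType}.
Implicit Types z w : R[i].

Lemma normc_ge0 z : 0 <= normc z.
Proof. by case: z => x y; exact: sqrtr_ge0. Qed.

Lemma normc_eq0 z : (normc z == 0) = (z == 0).
Proof.
apply/eqP/eqP => [/eq0_normc //|->].
exact: normc0.
Qed.

Lemma normc_gt0 z : (0 < normc z) = (z != 0).
Proof. by rewrite lt_def normc_eq0 normc_ge0 andbT. Qed.

Lemma normcB z w : normc (z - w) = normc (w - z).
Proof. by rewrite -normcN opprB. Qed.

Lemma le_normcB z w : normc z - normc w <= normc (z - w).
Proof. by have := le_normcD (z - w) w; rewrite subrK; lra. Qed.

Lemma normc_sqr z : normc z ^+ 2 = Re z ^+ 2 + Im z ^+ 2.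
Proof. by case: z => x y /=; rewrite sqr_sqrtr // addr_ge0 ?sqr_ge0. Qed.

Lemma normcR (x : R) : normc x%:C = `|x|.
Proof. by rewrite /= expr0n addr0 sqrtr_sqr. Qed.

Lemma normc_prod (I : Type) (r : seq I) (P : pred I) (F : I -> R[i]) :
  normc (\prod_(i <- r | P i) F i) = \prod_(i <- r | P i) normc (F i).
Proof.
by apply: (big_morph _ (@normcM R)
  (normc1 R)).
Qed.

Lemma le_Re_normc z : `|Re z| <= normc z.
Proof.
case: z => x y /=; rewrite -sqrtr_sqr ler_sqrt ?addr_ge0 ?sqr_ge0 //.
by rewrite lerDl sqr_ge0.
Qed.

Lemma le_Im_normc z : `|Im z| <= normc z.
Proof.
case: z => x y /=; rewrite -sqrtr_sqr ler_sqrt ?addr_ge0 ?sqr_ge0 //.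
by rewrite lerDr sqr_ge0.
Qed.

Lemma normc_le_ReIm z : normc z <= `|Re z| + `|Im z|.
Proof.
rewrite -(ler_pXn2r (_ : 0 < 2)%N) ?nnegrE ?normc_ge0 ?addr_ge0 //.
rewrite normc_sqr sqrrD !real_normK ?num_real // lerD2r lerDl.
by rewrite mulrn_wge0 // mulr_ge0.
Qed.

(** Balls in [(R[i])^o] have complex radii; a positive complex radius is real, so real radii
    suffice. *)
Lemma nbhs_normcP z (P : set (R[i])^o) :
  nbhs (z : (R[i])^o) P <->
  exists2 r : R, 0 < r & forall w, normc (w - z) < r -> P w.
Proof.
split=> [/nbhs_ballP[e e0 H]|[r r0 H]]; last first.
  apply/nbhs_ballP; exists (r%:C); first by rewrite /= ltcR.
  move=> w; rewrite -ball_normE /= => zw; apply: H.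
  by move: zw; rewrite distrC normc_def ltcR; case: (w - z).
have er : e = (Re e)%:C.
  by rewrite RRe_real // realE ltW.
move: e0 H; rewrite er /= ltcR => e0 H; exists (Re e) => // w zw; apply: H.
rewrite -ball_normE /= distrC normc_def ltcR.
by move: zw; case: (w - z).
Qed.

Lemma continuous_normc_dist z : continuous (fun w : (R[i])^o => normc (w - z)).
Proof.
move=> w U /nbhs_ballP[e /= e0 H]; rewrite nbhs_simpl.
apply/nbhs_normcP; exists e => // v vw; apply: H; rewrite -ball_normE /=.
have := le_normcB (w - z) (v - z); have := le_normcB (v - z) (w - z).
rewrite (_ : v - z - _ = v - w); last by ring.
rewrite (_ : w - z - _ = w - v); last by ring.
by rewrite (normcB w v) distrC ltr_norml => ? ?; apply/andP; split; lra.
Qed.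

Lemma closed_normc_disc z (r : R) :
  closed [set w : (R[i])^o | normc (w - z) <= r].
Proof.
rewrite (_ : [set _ | _] =
  (fun w : (R[i])^o => normc (w - z)) @^-1` [set x | x <= r]) //.
by apply: closed_comp => [w _|]; [exact: continuous_normc_dist|exact: closed_le].
Qed.

(** The disc is a closed subset of the image of a compact rectangle under the continuous map from
    pairs of reals to complex numbers. Compactness serves both the minimum in the implicit function
    theorem and the neighbourhoods of infinity on the sphere. *)
Lemma compact_normc_disc z (r : R) :
  compact [set w : (R[i])^o | normc (w - z) <= r].
Proof.
pose c (p : R * R) : (R[i])^o := p.1 +i* p.2.
have cc : continuous c.
  move=> p U /nbhs_normcP[e e0 H]; change (\forall q \near p, U (c q)); near=> q; apply: H.
  apply: le_lt_trans (normc_le_ReIm _) _ => /=.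
  have h1 : `|q.1 - p.1| < e / 2.
    near: q; apply: (@cvgr_distC_lt _ _ _ (nbhs p) _ fst p.1) ; last by rewrite divr_gt0.
    exact: cvg_fst.
  have h2 : `|q.2 - p.2| < e / 2.
    near: q; apply: (@cvgr_distC_lt _ _ _ (nbhs p) _ snd p.2) ; last by rewrite divr_gt0.
    exact: cvg_snd.
  lra.
pose K := `[Re z - r, Re z + r] `*` `[Im z - r, Im z + r].
have cK : compact (c @` K).
  apply: continuous_compact; first by apply: continuous_subspaceT.
  by apply: compact_setX; exact: segment_compact.
apply: subclosed_compact cK _; first exact: closed_normc_disc.
move=> w /= wr; exists (Re w, Im w); last by case: (w).
have := le_trans (le_Re_normc _) wr; have := le_trans (le_Im_normc _) wr.
rewrite !raddfB /= !ler_norml => /andP[? ?] /andP[? ?].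
by split; rewrite /= in_itv /=; apply/andP; split; lra.
Unshelve. all: by end_near. Qed.

End ComplexModulus.

(** * Strict differentiability *)

Section StrictDifferentiability.
Context {R : realType}.
Implicit Types (f g : R[i] * R[i] -> R[i]) (p q a : R[i] * R[i]) (d : R[i]).

Definition pnorm p : R := normc p.1 + normc p.2.

Lemma pnorm_ge0 p : 0 <= pnorm p.
Proof. by rewrite addr_ge0 ?normc_ge0. Qed.

Lemma pnorm0 : pnorm 0 = 0.
Proof. by rewrite /pnorm normc0 addr0. Qed.

Lemma pnorm_pair (x y x' y' : R[i]) :
  pnorm ((x, y) - (x', y')) = normc (x - x') + normc (y - y').
Proof. by []. Qed.

(* Strict complex differentiability at a, with partial derivatives d1 and d2:
   it gives the implicit function theorem without a mean value theorem. *)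
Definition sdiff f a (d1 d2 : R[i]) := forall e : R, 0 < e ->
  \forall r \near 0^'+, forall p q, pnorm (p - a) < r -> pnorm (q - a) < r ->
  normc (f p - f q - (d1 * (p - q).1 + d2 * (p - q).2)) <= e * pnorm (p - q).

Lemma eq_sdiff f g a (d1 d2 : R[i]) : f =1 g ->
  sdiff f a d1 d2 -> sdiff g a d1 d2.
Proof. by move=> /funext ->. Qed.

Lemma sdiff_cst c a : sdiff (fun _ => c) a 0 0.
Proof.
move=> e e0; near=> r => p q _ _.
rewrite !mul0r subrr addr0 subr0 normc0.
by rewrite mulr_ge0 ?pnorm_ge0 // ltW.
Unshelve. all: by end_near. Qed.

Lemma sdiff_fst a : sdiff fst a 1 0.
Proof.
move=> e e0; near=> r => p q _ _.
rewrite mul0r mul1r addr0 /= subrr normc0.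
by rewrite mulr_ge0 ?pnorm_ge0 // ltW.
Unshelve. all: by end_near. Qed.

Lemma sdiff_snd a : sdiff snd a 0 1.
Proof.
move=> e e0; near=> r => p q _ _.
rewrite mul0r mul1r add0r /= subrr normc0.
by rewrite mulr_ge0 ?pnorm_ge0 // ltW.
Unshelve. all: by end_near. Qed.

Lemma sdiff_add f g a (c1 c2 d1 d2 : R[i]) : sdiff f a c1 c2 -> sdiff g a d1 d2 ->
  sdiff (fun p => f p + g p) a (c1 + d1) (c2 + d2).
Proof.
move=> hf hg e e0; have e2 : 0 < e / 2 by rewrite divr_gt0.
near=> r => p q pr qr.
have hf' : normc (f p - f q - (c1 * (p - q).1 + c2 * (p - q).2)) <=
    e / 2 * pnorm (p - q) by apply: (near (hf _ _) r) pr qr.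
have hg' : normc (g p - g q - (d1 * (p - q).1 + d2 * (p - q).2)) <=
    e / 2 * pnorm (p - q) by apply: (near (hg _ _) r) pr qr.
apply: le_trans (_ : e / 2 * pnorm (p - q) + e / 2 * pnorm (p - q) <= _).
  apply: le_trans (lerD hf' hg'); apply: le_trans (le_normcD _ _).
  by rewrite le_eqVlt; apply/orP; left; apply/eqP; congr normc; ring.
by rewrite -mulrDl -splitr.
Unshelve. all: by end_near. Qed.

Lemma normc_linear_le d1 d2 p :
  normc (d1 * p.1 + d2 * p.2) <= (normc d1 + normc d2) * pnorm p.
Proof.
apply: le_trans (le_normcD _ _) _; rewrite !normcM /pnorm.
have := mulr_ge0 (normc_ge0 d1) (normc_ge0 p.2).
have := mulr_ge0 (normc_ge0 d2) (normc_ge0 p.1).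
lra.
Qed.

Lemma sdiff_lipschitz f a d1 d2 : sdiff f a d1 d2 ->
  \forall r \near 0^'+, forall p q, pnorm (p - a) < r -> pnorm (q - a) < r ->
  normc (f p - f q) <= (normc d1 + normc d2 + 1) * pnorm (p - q).
Proof.
move=> hf; near=> r => p q pr qr.
have hf' : normc (f p - f q - (d1 * (p - q).1 + d2 * (p - q).2)) <=
    1 * pnorm (p - q) by apply: (near (hf _ _) r) pr qr.
rewrite [X in normc X](_ : _ = (f p - f q - (d1 * (p - q).1 + d2 * (p - q).2)) +
  (d1 * (p - q).1 + d2 * (p - q).2)); last by ring.
apply: le_trans (le_normcD _ _) _; have := normc_linear_le d1 d2 (p - q).
lra.
Unshelve. all: by end_near. Qed.

Lemma sdiff_continuous f a d1 d2 e : sdiff f a d1 d2 -> 0 < e ->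
  \forall r \near 0^'+, forall p, pnorm (p - a) < r -> normc (f p - f a) < e.
Proof.
move=> hf e0; set K := normc d1 + normc d2 + 1.
have K0 : 0 < K by rewrite ltr_wpDl // addr_ge0 ?normc_ge0.
near=> r => p pr.
have r0 : 0 < r by [].
apply: (@le_lt_trans _ _ (K * pnorm (p - a))).
  have ar : pnorm (a - a) < r by rewrite subrr /pnorm normc0 addr0.
  by apply: (near (sdiff_lipschitz hf) r).
apply: lt_trans (_ : K * r < _); first by rewrite ltr_pM2l.
by rewrite mulrC -ltr_pdivlMr //; near: r; apply: nbhs_right_lt; rewrite divr_gt0.
Unshelve. all: by end_near. Qed.

Lemma le_normcM (x y : R[i]) (b c : R) :
  normc x <= b -> normc y <= c -> normc (x * y) <= b * c.
Proof. by move=> xb yc; rewrite normcM ler_pM ?normc_ge0. Qed.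

Lemma sdiff_mul f g a (c1 c2 d1 d2 : R[i]) :
  sdiff f a c1 c2 -> sdiff g a d1 d2 ->
  sdiff (fun p => f p * g p) a (c1 * g a + f a * d1) (c2 * g a + f a * d2).
Proof.
move=> hf hg e e0.
set C := normc c1 + normc c2; set D := normc d1 + normc d2.
set F := normc (f a); set G := normc (g a).
have [C0 D0] : 0 <= C /\ 0 <= D by rewrite !addr_ge0 ?normc_ge0.
have [F0 G0] : 0 <= F /\ 0 <= G by rewrite !normc_ge0.
(* The four summands are the coefficients of [e'] in the four error terms of the product rule
   below. *)
pose S := (G + 1) + C + (F + 1) + D.
have S0 : 0 < S by rewrite /S; lra.
pose e' := e / S; have e'0 : 0 < e' by rewrite divr_gt0.
near=> r => p q pr qr.
have hfpq := near (hf _ e'0) r _ p q pr qr.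
have hgpq := near (hg _ e'0) r _ p q pr qr.
have hfp : normc (f p - f a) < e' by apply: (near (sdiff_continuous hf e'0) r).
have hf1 : normc (f p - f a) < 1 by apply: (near (sdiff_continuous hf ltr01) r).
have hgq : normc (g q - g a) < e' by apply: (near (sdiff_continuous hg e'0) r).
have hg1 : normc (g q - g a) < 1 by apply: (near (sdiff_continuous hg ltr01) r).
have fp : normc (f p) <= F + 1.
  by have := le_normcB (f p) (f a); rewrite -/F; lra.
have gq : normc (g q) <= G + 1.
  by have := le_normcB (g q) (g a); rewrite -/G; lra.
have LC := normc_linear_le c1 c2 (p - q).
have LD := normc_linear_le d1 d2 (p - q).
set M := pnorm (p - q) in hfpq hgpq LC LD *.
move: hfpq hgpq LC LD.
set lc := c1 * _ + _; set ld := d1 * _ + _ => /(_ _)hfpq /(_ _)hgpq LC LD.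
have -> : f p * g p - f q * g q - ((c1 * g a + f a * d1) * (p - q).1 +
    (c2 * g a + f a * d2) * (p - q).2) =
  (f p - f q - lc) * g q + lc * (g q - g a) + f p * (g p - g q - ld) +
    (f p - f a) * ld by rewrite /lc /ld; ring.
have -> : e * M = e' * M * (G + 1) + C * M * e' + (F + 1) * (e' * M) + e' * (D * M).
  rewrite (_ : e = e' * S); last by rewrite /e' divfK // gt_eqF.
  by rewrite /S; ring.
do !apply: le_trans (le_normcD _ _) (lerD _ _); apply: le_normcM => //.
all: try exact: ltW.
- exact: hfpq.
- exact: hgpq.
Unshelve. all: by end_near. Qed.

Lemma sdiff_comp f g1 g2 a (d1 d2 b1 b2 c1 c2 : R[i]) :
  sdiff f (g1 a, g2 a) d1 d2 -> sdiff g1 a b1 b2 -> sdiff g2 a c1 c2 ->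
  sdiff (fun p => f (g1 p, g2 p)) a (d1 * b1 + d2 * c1) (d1 * b2 + d2 * c2).
Proof.
move=> hf h1 h2 e e0.
set K1 := normc b1 + normc b2 + 1; set K2 := normc c1 + normc c2 + 1.
have K10 : 0 < K1 by rewrite ltr_wpDl // addr_ge0 ?normc_ge0.
have K20 : 0 < K2 by rewrite ltr_wpDl // addr_ge0 ?normc_ge0.
have [D1 D2] : 0 <= normc d1 /\ 0 <= normc d2 by rewrite !normc_ge0.
pose S := K1 + K2 + normc d1 + normc d2.
have S0 : 0 < S by rewrite /S; lra.
pose e' := e / S; have e'0 : 0 < e' by rewrite divr_gt0.
(* The radius for the outer function is fixed first; the inner functions map a small enough ball
   into it and are Lipschitz there. *)
have [r' [r'0 hf']] : exists r', 0 < r' /\ forall p q, pnorm (p - (g1 a, g2 a)) < r' ->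
    pnorm (q - (g1 a, g2 a)) < r' ->
  normc (f p - f q - (d1 * (p - q).1 + d2 * (p - q).2)) <= e' * pnorm (p - q).
  near (0 : R)^'+ => r'; exists r'; split => //.
  by apply: (near (hf _ e'0) r').
have r'2 : 0 < r' / 2 by rewrite divr_gt0.
near=> r => p q pr qr.
have gr u : pnorm (u - a) < r -> pnorm ((g1 u, g2 u) - (g1 a, g2 a)) < r'.
  move=> ur; rewrite [r']splitr ltrD //=.
    by apply: (near (sdiff_continuous h1 r'2) r).
  by apply: (near (sdiff_continuous h2 r'2) r).
have /= hfpq := hf' _ _ (gr _ pr) (gr _ qr).
have L1 : _ <= K1 * _ := near (sdiff_lipschitz h1) r _ p q pr qr.
have L2 : _ <= K2 * _ := near (sdiff_lipschitz h2) r _ p q pr qr.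
have H1 := near (h1 _ e'0) r _ p q pr qr.
have H2 := near (h2 _ e'0) r _ p q pr qr.
set M := pnorm (p - q) in L1 L2 H1 H2 *.
rewrite [X in normc X](_ : _ = (f (g1 p, g2 p) - f (g1 q, g2 q) -
    (d1 * (g1 p - g1 q) + d2 * (g2 p - g2 q))) +
  d1 * (g1 p - g1 q - (b1 * (p - q).1 + b2 * (p - q).2)) +
  d2 * (g2 p - g2 q - (c1 * (p - q).1 + c2 * (p - q).2))); last by ring.
have -> : e * M = e' * (K1 * M + K2 * M) + normc d1 * (e' * M) + normc d2 * (e' * M).
  rewrite (_ : e = e' * S); last by rewrite /e' divfK // gt_eqF.
  by rewrite /S; ring.
apply: le_trans (le_normcD _ _) (lerD _ _).
  apply: le_trans (le_normcD _ _) (lerD _ _).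
- by apply: le_trans hfpq _; rewrite ler_pM2l // lerD ?L1 ?L2.
- by apply: le_normcM => //; exact: H1.
- by apply: le_normcM => //; exact: H2.
Unshelve. all: by end_near. Qed.

End StrictDifferentiability.

(** * Real derivatives as first-order error bounds *)

Section RealDerivative.
Context {R : realType}.

(** Multiplying the difference quotient out removes the division and allows [y = x]; the bound then
    has the same shape as the complex estimates it is derived from. *)
Lemma is_derive_bound (f : R -> R) (x d : R) : is_derive x 1 f d <->
  forall e, 0 < e -> \forall r \near 0^'+, forall y, `|y - x| < r ->
    `|f y - f x - d * (y - x)| <= e * `|y - x|.
Proof.
pose q (h : R) : R := h^-1 *: ((f \o shift x) (h *: 1) - f x).
have qE h : h != 0 -> `|q h - d| = `|f (h + x) - f x - d * h| / `|h|.
  move=> h0; rewrite /q /= -normrV ?unitfE // -normrM; congr `|_|.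
  by rewrite /GRing.scale /= mulr1; field.
split=> [[df dE] e e0|H].
  have qd : q @ 0^' --> d by rewrite -dE; exact: df.
  have /cvgrPdist_le/(_ e e0) := qd.
  rewrite near_withinE => /nbhs_ballP[r /= r0 Hr].
  near=> s => y ys; have [->|yx] := eqVneq y x.
    by rewrite !subrr mulr0 subr0 normr0 mulr0.
  have h0 : y - x != 0 by rewrite subr_eq0.
  have := Hr (y - x) _ h0; rewrite distrC qE // subrK ler_pdivrMr ?normr_gt0 //.
  apply; rewrite /ball /= sub0r normrN (lt_trans ys) //.
have qd : q @ 0^' --> d.
  apply/cvgrPdist_le => e e0; near (0 : R)^'+ => s.
  have Hs := near (H e e0) s.
  rewrite near_withinE; apply/nbhs_ballP; exists s => //= h.
  rewrite /ball /= sub0r normrN => hs h0.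
  rewrite distrC qE // ler_pdivrMr ?normr_gt0 //.
  by have := Hs _ (h + x); rewrite addrK; exact.
by split; [apply/cvg_ex; exists d|exact: cvg_lim].
Unshelve. all: by end_near. Qed.

End RealDerivative.

(** * The complex exponential and its strict derivative *)

Section ComplexExponential.
Context {R : realType}.
Implicit Types (z w h : R[i]).

Lemma cexpD z w : cexp (z + w) = cexp z * cexp w.
Proof.
case: z w => [x y] [x' y']; rewrite /cexp /= expRD cosD sinD; simpc.
by apply/eqP; rewrite eq_complex /=; apply/andP; split; apply/eqP; ring.
Qed.

Lemma cexp0 : cexp 0 = 1 :> R[i].
Proof. by rewrite /cexp /= expR0 cos0 sin0 mulr1 mulr0. Qed.

Lemma normc_cexp z : normc (cexp z) = expR (Re z).
Proof.
rewrite /cexp /= !exprMn -mulrDr cos2Dsin2 mulr1 sqrtr_sqr.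
by rewrite ger0_norm // expR_ge0.
Qed.

Lemma cexp_bound (e : R) : 0 < e ->
  \forall r \near 0^'+, forall h, normc h < r ->
    normc (cexp h - 1 - h) <= e * normc h.
Proof.
(* The real and imaginary parts together produce errors of [1 + 2 + 2 + 1 = 6] times [e' * normc h];
   the factors 2 bound [expR x] for [x] below 1/2. *)
move=> e0; pose e' := e / 6; have e'0 : 0 < e' by rewrite divr_gt0.
have /is_derive_bound dE : is_derive (0 : R) 1 expR 1.
  by rewrite -[X in is_derive _ _ _ X]expR0; exact: is_derive_expR.
have /is_derive_bound dC : is_derive (0 : R) 1 cos 0.
  rewrite -[X in is_derive _ _ _ X]oppr0 -[X in - X]sin0.
  exact: is_derive_cos.
have /is_derive_bound dS : is_derive (0 : R) 1 sin 1.
  by rewrite -[X in is_derive _ _ _ X]cos0; exact: is_derive_sin.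
have half0 : 0 < 1 / 2 :> R by rewrite divr_gt0.
have e'2 : 0 < e' / 2 by rewrite divr_gt0.
near=> r => h hr; have r1 : r < 1 / 2 by apply: (near (nbhs_right_lt half0) r).
have re : r < e' / 2 by apply: (near (nbhs_right_lt e'2) r).
have xr := le_lt_trans (le_Re_normc h) hr; have yr := le_lt_trans (le_Im_normc h) hr.
have xh := le_Re_normc h; have yh := le_Im_normc h.
set x := Re h in xr xh *; set y := Im h in yr yh *.
have HE : `|expR x - expR 0 - 1 * (x - 0)| <= e' * `|x - 0|.
  by apply: (near (dE _ e'0) r); rewrite // subr0.
have HE1 : `|expR x - expR 0 - 1 * (x - 0)| <= 1 * `|x - 0|.
  by apply: (near (dE _ ltr01) r); rewrite // subr0.
have HC : `|cos y - cos 0 - 0 * (y - 0)| <= e' * `|y - 0|.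
  by apply: (near (dC _ e'0) r); rewrite // subr0.
have HS : `|sin y - sin 0 - 1 * (y - 0)| <= e' * `|y - 0|.
  by apply: (near (dS _ e'0) r); rewrite // subr0.
rewrite ?subr0 ?sin0 ?cos0 ?expR0 ?mul0r ?mul1r ?subr0 in HE HE1 HC HS.
apply: le_trans (normc_le_ReIm _) _; rewrite /cexp !raddfB /= -/x -/y.
have E2 : `|expR x - 1| <= 2 * `|x|.
  rewrite (_ : expR x - 1 = (expR x - 1 - x) + x); last by ring.
  by apply: le_trans (ler_normD _ _) _; lra.
have E3 : `|expR x| <= 2.
  rewrite (_ : expR x = (expR x - 1) + 1); last by ring.
  by apply: le_trans (ler_normD _ _) _; rewrite normr1; lra.
have -> : expR x * cos y - 1 - x = (expR x - 1 - x) + expR x * (cos y - 1) by ring.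
have -> : expR x * sin y - 0 - y = expR x * (sin y - y) + (expR x - 1) * y by ring.
have B1 : `|expR x * (cos y - 1)| <= 2 * (e' * `|y|) by rewrite normrM ler_pM.
have B2 : `|expR x * (sin y - y)| <= 2 * (e' * `|y|) by rewrite normrM ler_pM.
have B3 : `|(expR x - 1) * y| <= e' * `|y| by rewrite normrM ler_pM //; lra.
have B4 : e' * `|x| <= e' * normc h by rewrite ler_pM2l.
have B5 : e' * `|y| <= e' * normc h by rewrite ler_pM2l.
have -> : e * normc h = 6 * (e' * normc h) by rewrite /e'; field.
have := ler_normD (expR x - 1 - x) (expR x * (cos y - 1)).
have := ler_normD (expR x * (sin y - y)) ((expR x - 1) * y).
lra.
Unshelve. all: by end_near. Qed.

(** By the functional equation the increment is [cexp q.1] times an increment at 0, so the bound at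
    0 transfers; replacing the factor [cexp q.1] by [cexp a.1] costs only a small multiple of the
    increment. *)
Lemma sdiff_cexp (a : R[i] * R[i]) : sdiff (fun p => cexp p.1) a (cexp a.1) 0.
Proof.
move=> e e0; set F := normc (cexp a.1).
have F0 : 0 < F by rewrite /F normc_cexp expR_gt0.
(* [F + 1] bounds [cexp q.1] in the first error term, and the second term contributes one more
   [e']. *)
pose e' := e / (F + 2); have e'0 : 0 < e' by rewrite divr_gt0 //; lra.
have [r' [r'0 hr']] : exists r' : R, 0 < r' /\ forall h, normc h < r' ->
    normc (cexp h - 1 - h) <= e' * normc h.
  near (0 : R)^'+ => r'; exists r'; split => //.
  by apply: (near (cexp_bound e'0) r').
have r'2 : 0 < r' / 2 by rewrite divr_gt0.
have F2 : 0 < 1 / (2 * F) by rewrite divr_gt0 // mulr_gt0.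
have e'2 : 0 < e' / (2 * F) by rewrite divr_gt0 // mulr_gt0.
near=> r => p q pr qr.
have r2 : r < r' / 2 by apply: (near (nbhs_right_lt r'2) r).
have r3 : r < 1 / (2 * F) by apply: (near (nbhs_right_lt F2) r).
have r4 : r < e' / (2 * F) by apply: (near (nbhs_right_lt e'2) r).
have pa : normc (p.1 - a.1) < r by apply: le_lt_trans pr; rewrite lerDl normc_ge0.
have qa : normc (q.1 - a.1) < r by apply: le_lt_trans qr; rewrite lerDl normc_ge0.
have pq : normc (p.1 - q.1) < r'.
  have := le_normcD (p.1 - a.1) (a.1 - q.1); rewrite addrA subrK (normcB a.1).
  lra.
have E1 : normc (cexp (q.1 - a.1) - 1) <= 2 * normc (q.1 - a.1).
  rewrite (_ : _ - 1 = (cexp (q.1 - a.1) - 1 - (q.1 - a.1)) + (q.1 - a.1)); last by ring.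
  apply: le_trans (le_normcD _ _) _.
  have : normc (cexp (q.1 - a.1) - 1 - (q.1 - a.1)) <= 1 * normc (q.1 - a.1).
    by apply: (near (cexp_bound ltr01) r).
  lra.
have E2 : normc (cexp q.1 - cexp a.1) <= F * (2 * normc (q.1 - a.1)).
  have -> : cexp q.1 - cexp a.1 = cexp a.1 * (cexp (q.1 - a.1) - 1).
    by rewrite mulrBr -cexpD mulr1 [a.1 + _]addrC subrK.
  exact: le_normcM.
have E3 : F * (2 * normc (q.1 - a.1)) <= F * (2 * r).
  by rewrite ler_pM2l // ler_pM2l // ltW.
rewrite ltr_pdivlMr ?mulr_gt0 // in r3.
rewrite ltr_pdivlMr ?mulr_gt0 // in r4.
have E4 : normc (cexp q.1) <= F + 1.
  by have := le_normcB (cexp q.1) (cexp a.1); rewrite -/F; lra.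
have -> : cexp p.1 - cexp q.1 - (cexp a.1 * (p - q).1 + 0 * (p - q).2) =
  cexp q.1 * (cexp (p.1 - q.1) - 1 - (p.1 - q.1)) + (cexp q.1 - cexp a.1) * (p.1 - q.1).
  have -> : cexp p.1 = cexp q.1 * cexp (p.1 - q.1).
    by rewrite -cexpD addrC subrK.
  by rewrite mul0r addr0 /=; ring.
apply: le_trans (le_normcD _ _) _.
have B1 := le_normcM E4 (hr' _ pq).
have B2 : normc ((cexp q.1 - cexp a.1) * (p.1 - q.1)) <= e' * normc (p.1 - q.1).
  by apply: le_normcM => //; lra.
have B3 : 0 <= e' * normc (p.1 - q.1) by rewrite mulr_ge0 ?normc_ge0 // ltW.
have -> : e = e' * (F + 2) by rewrite /e' divfK // gt_eqF //; lra.
apply: (@le_trans _ _ (e' * (F + 2) * normc (p.1 - q.1))); first by lra.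
rewrite ler_pM2l ?lerDl ?normc_ge0 // mulr_gt0 //; lra.
Unshelve. all: by end_near. Qed.
End ComplexExponential.

(** * The implicit function theorem *)

Section ImplicitFunction.
Context {R : realType}.
Implicit Types (c d u v : R[i]).

(* If c u + d v is negligible, then v is close to - (c / d) u; with u, v the
   increments of a solution of G = 0, this gives both the Lipschitz bound
   and the derivative of an implicit function. *)
Lemma implicit_bound c d (e : R) : d != 0 -> 0 < e ->
  exists2 e' : R, 0 < e' & forall u v,
    normc (c * u + d * v) <= e' * (normc u + normc v) ->
    normc (v + c / d * u) <= e * normc u.
Proof.
move=> d0 e0; set k := normc (c / d); have k0 : 0 <= k by exact: normc_ge0.
have D0 : 0 < normc d by rewrite normc_gt0.
have S0 : 0 < 1 + k + e by rewrite addr_gt0 // ltr_wpDr.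
pose e' := e * normc d / (1 + k + e).
have e'0 : 0 < e' by rewrite divr_gt0 // mulr_gt0.
exists e' => // u v.
set w := v + c / d * u; have -> : c * u + d * v = d * w by rewrite /w; field.
have vw : normc v <= normc w + k * normc u.
  have -> : v = w - c / d * u by rewrite /w addrK.
  by rewrite (le_trans (le_normcD _ _)) // normcN normcM.
rewrite normcM => H.
have H' : normc d * normc w <= e' * (normc u + (normc w + k * normc u)).
  by apply: le_trans H _; rewrite ler_pM2l // lerD2l.
have E : normc d - e' = normc d * (1 + k) / (1 + k + e).
  by rewrite /e'; field; rewrite gt_eqF.
have E' : 0 < normc d * (1 + k) / (1 + k + e).
  by rewrite divr_gt0 // mulr_gt0 // ltr_wpDr.
have H2 : (normc d - e') * normc w <= e' * (1 + k) * normc u by lra.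
rewrite -(ler_pM2l E') -E; apply: le_trans H2 _; rewrite E /e'.
by rewrite le_eqVlt; apply/orP; left; apply/eqP; field; rewrite gt_eqF.
Qed.

(* phi t minimizes the modulus of G (., t) on a closed disc; a Newton step at
   the minimum divides this modulus by 4, so the minimum is 0. *)
Lemma implicit_function (G : R[i] * R[i] -> R[i]) (a b d1 d2 : R[i]) :
  sdiff G (a, b) d1 d2 -> G (a, b) = 0 -> d1 != 0 ->
  exists (phi : R[i] -> R[i]) (r C : R),
    [/\ 0 < r, phi b = a,
      forall t, normc (t - b) < r -> G (phi t, t) = 0,
      forall s t, normc (s - b) < r -> normc (t - b) < r ->
        normc (phi s - phi t) <= C * normc (s - t) &
      forall e, 0 < e -> \forall r \near 0^'+, forall t, normc (t - b) < r ->
        normc (phi t - a + d2 / d1 * (t - b)) <= e * normc (t - b)].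
Proof.
move=> hG G0 d10.
have D0 : 0 < normc d1 by rewrite normc_gt0.
have D20 := normc_ge0 d2.
have [e1 e10 He1] := implicit_bound d2 d10 ltr01.
pose k := normc (d2 / d1) + 1.
have k0 : 0 < k by rewrite ltr_wpDl ?normc_ge0.
pose D4 := normc d1 / 4; have D40 : 0 < D4 by rewrite divr_gt0.
pose K := normc d2 + D4; have K0 : 0 < K by rewrite ltr_wpDl.
have [r0 [r00 sd1 sd4]] : exists r0 : R, [/\ 0 < r0,
    forall p q, pnorm (p - (a, b)) < r0 -> pnorm (q - (a, b)) < r0 ->
      normc (G p - G q - (d1 * (p - q).1 + d2 * (p - q).2)) <= e1 * pnorm (p - q) &
    forall p q, pnorm (p - (a, b)) < r0 -> pnorm (q - (a, b)) < r0 ->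
      normc (G p - G q - (d1 * (p - q).1 + d2 * (p - q).2)) <= D4 * pnorm (p - q)].
  near (0 : R)^'+ => r0; exists r0; split => //.
  - by apply: (near (hG _ e10) r0).
  - by apply: (near (hG _ D40) r0).
pose rho := r0 / 2; have rho0 : 0 < rho by rewrite divr_gt0.
(* The first bound keeps all points within [r0]; the second gives [normc (G (a, t)) <= rho * D4],
   small enough for the Newton step to stay in the disc. *)
pose r := Num.min (rho / 2) (rho * D4 / K).
have r_gt0 : 0 < r by rewrite lt_min !divr_gt0 // mulr_gt0.
have r_lt : r < rho by rewrite gt_min; apply/orP; left; lra.
have rK : r * K <= rho * D4 by rewrite -ler_pdivlMr // ge_min lexx orbT.
have inball x t : normc (x - a) <= rho -> normc (t - b) < r ->
    pnorm ((x, t) - (a, b)) < r0.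
  by move=> xa tb; rewrite /pnorm /=; move: r_lt; rewrite /rho in xa *; lra.
(* For [s = t] this is uniqueness of the zero in the disc. *)
have lip x s y t : normc (x - a) <= rho -> normc (s - b) < r ->
    normc (y - a) <= rho -> normc (t - b) < r -> G (x, s) = 0 -> G (y, t) = 0 ->
    normc (x - y) <= k * normc (s - t).
  move=> xa sb ya tb Gx Gy; have := sd1 _ _ (inball _ _ xa sb) (inball _ _ ya tb).
  rewrite Gx Gy subrr sub0r normcN /pnorm /= addrC [normc _ + _]addrC => /He1.
  have := le_normcD (x - y + d2 / d1 * (s - t)) (- (d2 / d1 * (s - t))).
  rewrite addrK normcN normcM /k; lra.
have ex t : normc (t - b) < r -> exists x, normc (x - a) <= rho /\ G (x, t) = 0.
  move=> tb.
  have aa : normc (a - a) <= rho by rewrite subrr normc0 ltW.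
  have bb : normc (b - b) < r by rewrite subrr normc0.
  have Dx x y : normc (x - a) <= rho -> normc (y - a) <= rho ->
      normc (G (x, t) - G (y, t) - d1 * (x - y)) <= D4 * normc (x - y).
    move=> xa ya; have := sd4 _ _ (inball _ _ xa tb) (inball _ _ ya tb).
    by rewrite /pnorm /= subrr mulr0 addr0 normc0 addr0.
  have eta_le : normc (G (a, t)) <= K * normc (t - b).
    have := sd4 _ _ (inball _ _ aa tb) (inball _ _ aa bb).
    rewrite G0 /pnorm /= subrr mulr0 add0r normc0 add0r subr0 => H.
    have := le_normcD (G (a, t) - d2 * (t - b)) (d2 * (t - b)).
    rewrite subrK normcM /K; lra.
  pose A := [set x : (R[i])^o | normc (x - a) <= rho].
  have [||x xA xmin] := compact_EVT_min _ (@compact_normc_disc R a rho)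
    (_ : {within A, continuous (fun x : (R[i])^o => normc (G (x, t)))}).
  - by exists a.
  - apply/subspace_continuousP => x xA U /nbhs_ballP[e /= e0 HU].
    suff : nbhs (x : (R[i])^o) (fun y => A y -> U (normc (G (y, t)))) by [].
    apply/nbhs_normcP.
    have L0 : 0 < normc d1 + D4 by rewrite addr_gt0.
    exists (e / (normc d1 + D4)); first by rewrite divr_gt0.
    move=> y; rewrite ltr_pdivlMr // => yx yA; apply: HU.
    rewrite -ball_normE /= ltr_norml.
    have := Dx y x yA xA; have := Dx x y xA yA; rewrite (normcB x y) => H1 H2.
    have := le_normcD (G (y, t) - G (x, t) - d1 * (y - x)) (d1 * (y - x)).
    have := le_normcD (G (x, t) - G (y, t) - d1 * (x - y)) (d1 * (x - y)).
    rewrite !subrK !normcM (normcB x y).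
    have := le_normcB (G (x, t)) (G (y, t)).
    have := le_normcB (G (y, t)) (G (x, t)).
    by move=> ????; rewrite /from_subspace; apply/andP; split; lra.
  have {}xA : normc (x - a) <= rho by move: xA; rewrite inE.
  exists x; split => //.
  have xa := xmin a; rewrite inE in xa; move: (xa aa) => {}xa.
  have Na : K * normc (t - b) <= rho * D4.
    by apply: le_trans rK; rewrite mulrC ler_pM2r // ltW.
  have N0 := normc_ge0 (G (x, t)).
  (* Minimality bounds [normc (G (x, t))] by [normc (G (a, t))], and [D4] absorbs a quarter of
     [normc d1 * normc (x - a)]. Hence [normc d1 * normc (x' - a)] is at most 8/3 + 1 = 11/3 times
     [normc (G (a, t))], that is at most 11/12 of [normc d1 * rho]. *)
  have h1 : 3 * (normc d1 * normc (x - a)) <= 8 * normc (G (a, t)).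
    have := Dx x a xA aa.
    have := le_normcD (G (x, t) - G (a, t) - d1 * (x - a)) (G (a, t) - G (x, t)).
    rewrite (_ : _ + (_ - _) = - (d1 * (x - a))); last by ring.
    rewrite normcN normcM; have := le_normcD (G (a, t)) (- G (x, t)).
    rewrite normcN /D4; lra.
  pose x' := x - G (x, t) / d1.
  have x'A : normc (x' - a) <= rho.
    rewrite -(ler_pM2l D0) -normcM /x'.
    have -> : d1 * (x - G (x, t) / d1 - a) = d1 * (x - a) - G (x, t) by field.
    have := le_normcD (d1 * (x - a)) (- G (x, t)); rewrite normcN normcM.
    move: Na; rewrite /D4; lra.
  have := Dx x' x x'A xA.
  have -> : x' - x = - (G (x, t) / d1) by rewrite /x' addrAC subrr sub0r.
  have -> : G (x', t) - G (x, t) - d1 * - (G (x, t) / d1) = G (x', t) by field.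
  rewrite normcN normcM normcV.
  have -> : D4 * (normc (G (x, t)) / normc d1) = normc (G (x, t)) / 4.
    by rewrite /D4; field; rewrite gt_eqF.
  (* The minimal modulus is at most the modulus at [x'], hence at most a quarter of itself. *)
  have xx' := xmin x'; rewrite inE in xx'; move: (xx' x'A) => {}xx' H.
  by apply/eqP; rewrite -normc_eq0; apply/eqP; lra.
(* The default [a] is never taken for [t] within [r] of [b], where a zero exists. *)
pose phi t := xget a [set x | normc (x - a) <= rho /\ G (x, t) = 0].
have phiP t : normc (t - b) < r -> normc (phi t - a) <= rho /\ G (phi t, t) = 0.
  by move=> /ex ext; rewrite /phi; case: xgetP => [? _|/(_ _)] //; case: ext => x ? /(_ x).
have bb : normc (b - b) < r by rewrite subrr normc0.
have phib : phi b = a.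
  have [h1 h2] := phiP b bb.
  have := lip _ _ a _ h1 bb _ bb h2 G0; rewrite !subrr normc0 mulr0 => /(_ (ltW rho0)) H.
  by apply/eqP; rewrite -subr_eq0 -normc_eq0 eq_le H normc_ge0.
exists phi, r, k; split => //.
- by move=> t /phiP[].
- by move=> s t sb tb; have [? ?] := phiP s sb; have [? ?] := phiP t tb; exact: lip.
- move=> e e0; have [e' e'0 He'] := implicit_bound d2 d10 e0.
  have [r' [r'0 Hr']] : exists r', 0 < r' /\ forall p q,
      pnorm (p - (a, b)) < r' -> pnorm (q - (a, b)) < r' ->
      normc (G p - G q - (d1 * (p - q).1 + d2 * (p - q).2)) <= e' * pnorm (p - q).
    near (0 : R)^'+ => r'; exists r'; split => //.
    by apply: (near (hG _ e'0) r').
  have r'k : 0 < r' / (k + 1) by rewrite divr_gt0 // addr_gt0.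
  near=> s => t ts.
  have sr : s < r by apply: (near (nbhs_right_lt r_gt0) s).
  have sr' : s < r' / (k + 1) by apply: (near (nbhs_right_lt r'k) s).
  have tr := lt_trans ts sr; have [pA pG] := phiP t tr.
  have := lip _ _ a _ pA tr _ bb pG G0; rewrite subrr normc0.
  move=> /(_ (ltW rho0)) pk.
  have small : pnorm ((phi t, t) - (a, b)) < r'.
    have : normc (t - b) * (k + 1) < r'.
      by rewrite -ltr_pdivlMr ?(lt_trans ts sr') // addr_gt0.
    by rewrite /pnorm /=; lra.
  have := Hr' _ (a, b) small; rewrite pG G0 subrr pnorm0 => /(_ r'0).
  rewrite subrr sub0r normcN /pnorm /= addrC [normc _ + _]addrC => /He'.
  by [].
Unshelve. all: by end_near. Qed.
End ImplicitFunction.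

(** * The characteristic polynomial *)

Section BivariatePolynomials.
Context {R : realType}.
Implicit Types (Q : {poly {poly R[i]}}) (c : {poly R[i]}) (a p : R[i] * R[i]).

Lemma sdiff_poly c a :
  exists d, sdiff (fun p => c.[p.2]) a 0 d.
Proof.
elim/poly_ind: c => [|c k [d hd]].
  by exists 0; apply: eq_sdiff (sdiff_cst 0 a) => p; rewrite horner0.
have := sdiff_add (sdiff_mul hd (sdiff_snd a)) (sdiff_cst k a).
rewrite !(mul0r, mulr0, addr0) => h.
by eexists; apply: eq_sdiff h => p; rewrite !hornerE.
Qed.

Lemma sdiff_poly2 Q a :
  exists d1 d2, sdiff (fun p => Q.[p.1%:P].[p.2]) a d1 d2.
Proof.
elim/poly_ind: Q => [|Q c [d1 [d2 hd]]].
  by exists 0, 0; apply: eq_sdiff (sdiff_cst 0 a) => p; rewrite !horner0.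
have [d hc] := sdiff_poly c a.
have h := sdiff_add (sdiff_mul hd (sdiff_fst a)) hc.
by eexists; eexists; apply: eq_sdiff h => p; rewrite !hornerE.
Qed.

Lemma sdiff_near (T : Type) (F : set_system T) {FF : Filter F}
    (f : R[i] * R[i] -> R[i]) a (d1 d2 : R[i]) (c : T -> R[i] * R[i]) :
  sdiff f a d1 d2 -> (forall e, 0 < e -> \forall t \near F, pnorm (c t - a) < e) ->
  forall e, 0 < e -> \forall t \near F, normc (f (c t) - f a) < e.
Proof.
move=> hf hc e e0.
have [r [r0 Hr]] : exists r : R, 0 < r /\ forall p, pnorm (p - a) < r ->
    normc (f p - f a) < e.
  near (0 : R)^'+ => r; exists r; split => //.
  by apply: (near (sdiff_continuous hf e0) r).
by apply: filterS (hc _ r0) => t; exact: Hr.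
Unshelve. all: by end_near. Qed.

Lemma cvg_normc (T : Type) (F : set_system T) {FF : Filter F} (g : T -> R[i]) l :
  (forall e : R, 0 < e -> \forall t \near F, normc (g t - l) < e) ->
  (fun t => normc (g t)) @ F --> normc l.
Proof.
move=> h; apply/cvgrPdist_lt => e /h; apply: filterS => t.
have := le_normcB (g t) l; have := le_normcB l (g t).
by rewrite (normcB l) ltr_norml => ? ? ?; apply/andP; split; lra.
Qed.

(** After the full power of [X - z] is divided out, the cofactor does not vanish at [z], hence not
    nearby. *)
Lemma poly_near_neq0 c (z : R[i]) : c != 0 ->
  exists2 r : R, 0 < r & forall w, w != z -> normc (w - z) < r -> c.[w] != 0.
Proof.
move=> c0; have [k [d]] := multiplicity_XsubC c z; rewrite c0 /= => dz ->.
have [d' hd] := sdiff_poly d (0, z).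
have D0 : 0 < normc d.[z] by rewrite normc_gt0.
near (0 : R)^'+ => r; exists r => // w wz wr.
rewrite hornerM mulf_neq0 // ?horner_exp ?expf_neq0 ?hornerXsubC ?subr_eq0 //.
have : normc (d.[w] - d.[z]) < normc d.[z].
  apply: (near (sdiff_continuous hd D0) r _ (0, w)) => //.
  by rewrite pnorm_pair subrr normc0 add0r.
by apply: contraTneq => ->; rewrite sub0r normcN ltxx.
Unshelve. all: by end_near. Qed.

Lemma poly_eq0_near c (z : R[i]) (r : R) : 0 < r ->
  (forall w, normc (w - z) < r -> c.[w] = 0) -> c = 0.
Proof.
move=> r0 H; apply/eqP; apply: contraT => /(poly_near_neq0 z)[s s0 Hs].
pose t : R := Num.min r s / 2.
have m0 : 0 < Num.min r s by rewrite lt_min r0.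
have t0 : 0 < t by rewrite divr_gt0.
have [mr ms] : Num.min r s <= r /\ Num.min r s <= s by rewrite !ge_min !lexx orbT.
have nt : normc (z + t%:C - z) = t by rewrite addrC addKr normcR gtr0_norm.
have := Hs (z + t%:C); rewrite nt H ?nt ?eqxx; last by rewrite /t; lra.
apply; last by rewrite /t; lra.
by rewrite -subr_eq0 addrC addKr -normc_eq0 normcR normr_eq0 gt_eqF.
Qed.

End BivariatePolynomials.

Section CharacteristicPolynomial.
Context {R : realType} {n : nat}.
Implicit Types (A B : 'M[R]_n) (l : R[i]).

(* det (l - A - B y), with l as outer and y as inner variable. *)
Definition charpoly2 A B : {poly {poly R[i]}} :=
  char_poly (map_mx polyC (cmx A) + 'X *: map_mx polyC (cmx B)).

Lemma charpoly2E A B l : (charpoly2 A B).[l%:P] =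
  \det (map_mx polyC (l%:M - cmx A) - 'X *: map_mx polyC (cmx B)).
Proof.
rewrite /charpoly2 /char_poly -[LHS]/(horner_eval l%:P _) -det_map_mx; congr (\det _).
apply/matrixP => i j; rewrite !mxE /= /horner_eval.
by case: (i == j); rewrite ?mulr1n ?mulr0n !hornerE /= ?polyCB ?polyCN opprD ?addrA ?sub0r.
Qed.

Lemma genpolyE A B omega : genpoly A B omega = (charpoly2 A B).[(0 +i* omega)%:P].
Proof. by rewrite charpoly2E. Qed.

Lemma charpoly2_horner A B l y :
  (charpoly2 A B).[l%:P].[y] = \det (l%:M - cmx A - y *: cmx B).
Proof.
rewrite charpoly2E -[LHS]/(horner_eval y _) -det_map_mx; congr (\det _).
by apply/matrixP => i j; rewrite !mxE /= /horner_eval !hornerE.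
Qed.

Lemma charpoly2_neq0 A B : charpoly2 A B != 0.
Proof. exact/monic_neq0/char_poly_monic. Qed.

(** The coefficient of [Y^m] is a polynomial in [i omega]. It is not zero, since degree [m] is
    attained somewhere, so its zeros are isolated; away from them the generating polynomial has
    positive degree. *)
Lemma nondegenerate_near A B m omega : (0 < m)%N ->
  (exists omega, size (genpoly A B omega) = m.+1) ->
  \forall omega' \near omega^', ~ degenerate A B omega'.
Proof.
move=> m0 [w sw]; pose P := charpoly2 A B.
pose c : {poly R[i]} := \poly_(i < size P) P`_i`_m.
have cE l : c.[l] = (P.[l%:P])`_m.
  rewrite horner_poly horner_coef coef_sum; apply: eq_bigr => i _.
  by rewrite -polyC_exp coefMC.
have c0 : c != 0.
  apply: contra_eq_neq sw => cc; apply/eqP => sw.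
  have /eqP := cE (0 +i* w); rewrite cc horner0 -genpolyE eq_sym.
  rewrite -[m]/(m.+1.-1) -sw -lead_coefE lead_coef_eq0 => /eqP g0.
  by rewrite g0 size_poly0 in sw.
have [r r0 Hr] := poly_near_neq0 (0 +i* omega) c0.
rewrite near_withinE; apply/nbhs_ballP; exists r => // w'.
rewrite /ball /= distrC => ww' wn deg.
have : c.[0 +i* w'] != 0.
  apply: Hr; first by rewrite eq_complex /= eqxx.
  rewrite (_ : _ - _ = 0 +i* (w' - omega)); last by simpc.
  by rewrite /= expr0n add0r sqrtr_sqr.
by rewrite cE -genpolyE deg coefC; case: (m) m0 => //= ? _; rewrite eqxx.
Qed.

End CharacteristicPolynomial.

(** * Branches of the spectrum *)

Section SpectralBranches.
Context {R : realType}.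

Section curve.
Variables (Y : R -> csphere R) (omega : R) (y0 : R[i]).
Hypothesis cY : {for omega, continuous Y}.

Let near_branch U : nbhs (Y omega) U -> \forall w \near omega, U (Y w).
Proof. exact: cY. Qed.

Lemma csphere_near_away : Y omega <> Some y0 -> exists2 e : R, 0 < e &
  \forall w \near omega, forall y : R[i], Y w = Some y -> e <= normc (y - y0).
Proof.
case E : (Y omega) => [y1|] y1y0.
  have y10 : 0 < normc (y1 - y0).
    by rewrite normc_gt0 subr_eq0; apply: contra_not_neq y1y0 => ->.
  exists (normc (y1 - y0) / 2); first by rewrite divr_gt0.
  have /near_branch : nbhs (Y omega)
      (Some @` [set y : (R[i])^o | normc (y - y1) < normc (y1 - y0) / 2]).
    rewrite E; apply: (@one_point_compactification_some_nbhs (R[i])^o y1).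
    apply/nbhs_normcP; by exists (normc (y1 - y0) / 2); rewrite ?divr_gt0.
  apply: filterS => w [y /= yy <-] _ [<-].
  have := le_normcB (y1 - y0) (y1 - y); rewrite (normcB y1 y).
  rewrite (_ : y1 - y0 - _ = y - y0); last by ring.
  lra.
exists 1 => //.
(* If the branch is at infinity, the complement of this compact disc, together with infinity, is a
   neighbourhood that it does not leave. *)
pose D := [set y : (R[i])^o | normc (y - y0) <= 1].
have /near_branch : nbhs (Y omega) ((Some @` ~` D) `|` [set None]).
  rewrite E; exists D => //.
  by split; [exact: compact_normc_disc|exact: closed_normc_disc].
apply: filterS => w [[y /= yy <-] _ [<-]|/= -> //].
by rewrite leNgt; apply/negP => /ltW.
Qed.

Lemma csphere_near_close : Y omega = Some y0 -> forall e : R, 0 < e ->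
  \forall w \near omega, exists2 y : R[i], Y w = Some y & normc (y - y0) < e.
Proof.
move=> E e e0.
have /near_branch : nbhs (Y omega) (Some @` [set y : (R[i])^o | normc (y - y0) < e]).
  rewrite E; apply: (@one_point_compactification_some_nbhs (R[i])^o y0).
  by apply/nbhs_normcP; exists e.
by apply: filterS => w [y /= yy <-]; exists y.
Qed.

End curve.

(* A Harnack inequality replaces the continuity of roots. For t near omega,
   each factor y - Y_k(t) whose limit does not vanish at y0 varies by at most
   a factor 2 over a small disc around y0. Here Q is what remains of
   det (l - A - B y) after division by the power of l - i omega that it
   contains, so that degenerate omega are covered as well. *)
Lemma harnack_branches n (A B : 'M[R]_n) m (Y : 'I_m -> R -> csphere R)
    (omega : R) (y0 : R[i]) (Q : {poly {poly R[i]}}) s :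
  acs_roots A B Y -> (0 < m)%N ->
  charpoly2 A B = Q * ('X - (0 +i* omega)%:P%:P) ^+ s ->
  exists2 r : R, 0 < r & forall z w, normc (z - y0) < r -> normc (w - y0) < r ->
    normc Q.[(0 +i* omega)%:P].[z] *
      \prod_(k < m | `[< Y k omega = Some y0 >]) normc (w - y0) <=
    2 ^+ m * (normc Q.[(0 +i* omega)%:P].[w] *
      \prod_(k < m | `[< Y k omega = Some y0 >]) normc (z - y0)).
Proof.
move=> [exm cY rootsY] m0 PQ; pose S k := `[< Y k omega = Some y0 >].
(* If [y] is at distance at least [3 * r] from [y0], then [normc (w - y) >= 2 * r] and
   [normc (z - w) <= 2 * r], which gives the factor 2 between [normc (z - y)] and
   [normc (w - y)]. *)
have away : \forall r \near (0 : R)^'+, forall k, ~~ S k ->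
    \forall w \near omega, forall y : R[i], Y k w = Some y -> 3 * r <= normc (y - y0).
  apply: filter_forall => k; case Sk : (S k); first by near=> r.
  have /csphere_near_away : Y k omega <> Some y0 by move/asboolPn: Sk.
  move=> /(_ (cY k omega))[e e0 He].
  have e3 : 0 < e / 3 by rewrite divr_gt0.
  near=> r => _; apply: filterS He => w Hw y /Hw; apply: le_trans.
  have : r < e / 3 by apply: (near (nbhs_right_lt e3) r).
  lra.
near (0 : R)^'+ => r; exists r => // z w zr wr.
pose u k t x := normc (root_factor (Y k t)).[x].
pose q t := Q.[(0 +i* t)%:P].
have cvq x : (fun t => normc (q t).[x]) @ omega^' --> normc (q omega).[x].
  have [d1 [d2 hQ]] := sdiff_poly2 Q (0 +i* omega, x).
  apply: cvg_normc => e e0.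
  apply: (sdiff_near (c := fun t => (0 +i* t, x)) hQ) => // {}e {}e0.
  rewrite near_withinE; apply/nbhs_ballP; exists e => // t.
  rewrite /ball /= distrC => te _; rewrite pnorm_pair subrr normc0 addr0.
  rewrite (_ : _ - _ = 0 +i* (t - omega)); last by simpc.
  by rewrite /= expr0n add0r sqrtr_sqr.
have cvu k x : S k -> (fun t => u k t x) @ omega^' --> normc (x - y0).
  move=> /asboolP Sk; apply: cvg_normc => e e0.
  have := csphere_near_close (cY k omega) Sk e0.
  move=> /nbhs_ballP[d /= d0 Hd].
  rewrite near_withinE; apply/nbhs_ballP; exists d => // t td tn.
  have [y -> yy] := Hd _ td; rewrite /= hornerXsubC.
  by rewrite (_ : _ - _ = y0 - y); [rewrite normcB|ring].
have cvS x : (fun t => \prod_(k < m | S k) u k t x) @ omega^' -->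
    \prod_(k < m | S k) normc (x - y0).
  by apply: cvg_big => [|k]; [exact: mul_continuous|exact: cvu].
(* The inequality is proved for [t != omega], where the root equation is available, and passes to
   the limit. *)
apply: (ler_cvg_to (a := omega^')
  (f := fun t => normc (q t).[z] * \prod_(k < m | S k) u k t w)
  (g := fun t => 2 ^+ m * (normc (q t).[w] * \prod_(k < m | S k) u k t z))).
- exact: cvgM.
- by apply: cvgMl_tmp; exact: cvgM.
have nd := nondegenerate_near omega m0 exm.
have away' : \forall t \near omega^', forall k, ~~ S k -> forall y : R[i],
    Y k t = Some y -> 3 * r <= normc (y - y0).
  apply: filter_forall => k; case Sk : (S k); first by near=> t.
  have : \forall t \near omega, forall y : R[i], Y k t = Some y -> 3 * r <= normc (y - y0).
    by move/negbT: Sk; exact: (near away r).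
  by move=> /nbhs_dnbhs; apply: filterS => t Ht _.
have tn : \forall t \near omega^', t != omega by exact: nbhs_dnbhs_neq.
near=> t.
have ndt : ~ degenerate A B t by apply: (near nd t).
have ton : t != omega by exact: (near tn t).
have awayt k : ~~ S k -> forall y : R[i], Y k t = Some y -> 3 * r <= normc (y - y0).
  by exact: (near away' t).
(* This positive factor relates [Q] to the generating polynomial; it is the same for [z] and [w] and
   cancels. *)
pose d := normc ((0 +i* t) - (0 +i* omega)) ^+ s.
have d0 : 0 < d.
  rewrite exprn_gt0 // normc_gt0 subr_eq0 eq_complex /= eqxx //.
have qE x : normc (q t).[x] * d =
    normc (lead_coef (genpoly A B t)) * \prod_(k < m) u k t x.
  rewrite -normc_prod -normcM -horner_prod -hornerZ -rootsY // genpolyE PQ.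
  rewrite hornerM hornerM normcM horner_exp hornerXsubC -polyCB -polyC_exp hornerC.
  rewrite /d; congr (_ * _); elim: s {PQ d d0} => [|s IH].
    by rewrite !expr0 normc1.
  by rewrite !exprS normcM IH.
(* Branches in [S] contribute the same product to both sides, a branch at infinity contributes 1,
   and every other branch changes by at most the factor 2. *)
have main : (\prod_(k < m) u k t z) * \prod_(k < m | S k) u k t w <=
    2 ^+ m * ((\prod_(k < m) u k t w) * \prod_(k < m | S k) u k t z).
  have two : 2 ^+ m = \prod_(k < m) 2 :> R by rewrite prodr_const card_ord.
  rewrite two [X in _ * X <= _]big_mkcond [X in _ <= _ * (_ * X)]big_mkcond /=.
  rewrite -!big_split; apply: ler_prod => k _ /=; case Sk : (S k).
    rewrite mulr_ge0 ?normc_ge0 //= (mulrC (u k t w)).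
    by rewrite ler_peMl ?mulr_ge0 ?normc_ge0 // ler1n.
  rewrite !mulr1 normc_ge0 /= /u.
  case E : (Y k t) => [y|] /=; last by rewrite !hornerC normc1; lra.
  rewrite !hornerXsubC; have := awayt k _ y E; rewrite Sk => /(_ isT).
  have := le_normcD (w - y) (z - w); rewrite (_ : w - y + _ = z - y); last by ring.
  have := le_normcD (z - y0) (y0 - w); rewrite addrA subrK (normcB y0).
  have := le_normcB (y - y0) (w - y0); rewrite (_ : _ - _ - _ = y - w); last by ring.
  rewrite (normcB y w); lra.
rewrite -(ler_pM2r d0) mulrAC qE -mulrA.
have -> : 2 ^+ m * (normc (q t).[w] * \prod_(k < m | S k) u k t z) * d =
  2 ^+ m * (normc (q t).[w] * d * \prod_(k < m | S k) u k t z) by ring.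
rewrite qE; have := ler_wpM2l (normc_ge0 (lead_coef (genpoly A B t))) main.
lra.
Unshelve. all: by end_near. Qed.
End SpectralBranches.

(** * Roots at a point as branch values, and differentiation of a simple branch *)

Section BranchesThroughPoint.
Context {R : realType}.
Context {n : nat} (A B : 'M[R]_n) {m : nat} (Y : 'I_m -> R -> csphere R).
Variables (omega : R) (Q : {poly {poly R[i]}}) (s : nat) (y0 : R[i]).
Hypotheses (hY : acs_roots A B Y) (m0 : (0 < m)%N).
Hypothesis PQ : charpoly2 A B = Q * ('X - (0 +i* omega)%:P%:P) ^+ s.
Hypothesis Q0 : Q.[(0 +i* omega)%:P] != 0.
Let q0 := Q.[(0 +i* omega)%:P].

(** Without a branch through [y0] both products in the Harnack inequality are empty, so a zero at
    [y0] would spread to a whole disc and make [q0] vanish identically. *)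
Lemma root_on_branch : q0.[y0] = 0 -> exists k, Y k omega = Some y0.
Proof.
move=> qy; apply: contrapT => /forallNP noY.
have [r r0 H] := harnack_branches y0 hY m0 PQ.
move/negP: Q0; apply; apply/eqP; apply: (poly_eq0_near r0) => z zr.
have := H z y0 zr; rewrite subrr normc0 => /(_ r0).
rewrite !big_pred0; last 2 first.
- by move=> k; apply/asboolPn/noY.
- by move=> k; apply/asboolPn/noY.
rewrite -/q0 qy normc0 mul0r mulr0 mulr1 => h.
by apply/eqP; rewrite -normc_eq0 eq_le h normc_ge0.
Qed.

Variables (j : 'I_m).
Hypotheses (Yj : Y j omega = Some y0) (Yk : forall k, Y k omega = Some y0 -> k = j).

Lemma harnack_simple_branch : exists2 r : R, 0 < r & forall z w,
  normc (z - y0) < r -> normc (w - y0) < r ->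
  normc q0.[z] * normc (w - y0) <= 2 ^+ m * (normc q0.[w] * normc (z - y0)).
Proof.
have [r r0 H] := harnack_branches y0 hY m0 PQ; exists r => // z w zr wr.
have := H z w zr wr; rewrite !(big_pred1 j) // => k.
- by apply/asboolP/eqP => [/Yk|->].
- by apply/asboolP/eqP => [/Yk|->].
Qed.

(** With [z = y0] the right side of the Harnack inequality vanishes, while [w] can be chosen
    different from [y0]. *)
Lemma simple_branch_root : q0.[y0] = 0.
Proof.
have [r r0 H] := harnack_simple_branch.
have r2 : 0 < r / 2 by rewrite divr_gt0.
have nr : normc (y0 + (r / 2)%:C - y0) = r / 2 by rewrite addrC addKr normcR gtr0_norm.
have := H y0 (y0 + (r / 2)%:C); rewrite subrr normc0 nr !mulr0 => /(_ r0).
have -> : r / 2 < r by lra.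
move=> /(_ isT); rewrite pmulr_lle0 // => h.
by apply/eqP; rewrite -normc_eq0 eq_le h normc_ge0.
Qed.

(** If [d2] were 0, then [q0.[w]] would be negligible against [normc (w - y0)]; dividing the Harnack
    inequality by the latter and letting [w] tend to [y0] would give [q0.[z] = 0] on a disc. *)
Lemma simple_branch_derivative d1 d2 :
  sdiff (fun p => Q.[p.1%:P].[p.2]) (0 +i* omega, y0) d1 d2 -> d2 != 0.
Proof.
move=> hQ; apply/eqP => d20; rewrite {d2}d20 in hQ.
have [r r0 H] := harnack_simple_branch.
move/negP: Q0; apply; apply/eqP; apply: (poly_eq0_near r0) => z zr.
have C0 : 0 < 2 ^+ m * normc (z - y0) + 1.
  by rewrite ltr_wpDl // mulr_ge0 ?normc_ge0 // exprn_ge0.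
apply: contrapT => /eqP; rewrite -normc_gt0 => qz.
(* The summand 1 makes the resulting bound on [normc q0.[z]] strictly smaller than [normc q0.[z]]
   itself. *)
pose e := normc q0.[z] / (2 ^+ m * normc (z - y0) + 1).
have e0 : 0 < e by rewrite divr_gt0.
near (0 : R)^'+ => t.
have t0 : 0 < t by [].
have tr : t < r by exact: (near (nbhs_right_lt r0) t).
pose w := y0 + (t / 2)%:C.
have nw : normc (w - y0) = t / 2 by rewrite addrC addKr normcR gtr0_norm // divr_gt0.
have qw : normc q0.[w] <= e * (t / 2).
  have H1 : normc (q0.[w] - q0.[y0] - (d1 * (0 +i* omega - 0 +i* omega) + 0 * (w - y0))) <=
      e * pnorm ((0 +i* omega, w) - (0 +i* omega, y0)).
    apply: (near (hQ _ e0) t _ (0 +i* omega, w) (0 +i* omega, y0)) => //.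
      by rewrite pnorm_pair subrr normc0 add0r nw; lra.
    by rewrite subrr pnorm0.
  rewrite pnorm_pair subrr normc0 add0r nw in H1.
  by rewrite simple_branch_root mulr0 mul0r addr0 !subr0 in H1.
have := H z w zr; rewrite nw => /(_ _)H2.
have {H2} : normc q0.[z] * (t / 2) <= 2 ^+ m * (normc q0.[w] * normc (z - y0)).
  by apply: H2; lra.
have h3 : 2 ^+ m * normc (z - y0) * normc q0.[w] <=
    2 ^+ m * normc (z - y0) * (e * (t / 2)).
  by rewrite ler_wpM2l // mulr_ge0 ?normc_ge0 // exprn_ge0.
move=> h4; have : normc q0.[z] * (t / 2) <= (2 ^+ m * normc (z - y0) * e) * (t / 2) by lra.
rewrite ler_pM2r ?divr_gt0 // => h5.
have : normc q0.[z] = e * (2 ^+ m * normc (z - y0) + 1) by rewrite /e divfK // gt_eqF.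
lra.
Unshelve. all: by end_near. Qed.

(* Junk value 0 where the branch is at infinity. *)
Definition branch_value (t : R) : R[i] := oapp id 0 (Y j t).

(** For [t != omega] the power of [i t - i omega] is nonzero, so a root of the generating polynomial
    is a root of [Q]; at [omega] itself this is [simple_branch_root]. *)
Lemma branch_value_root : \forall t \near omega,
  Q.[(0 +i* t)%:P].[branch_value t] = 0.
Proof.
have [exm cY rootsY] := hY.
have nd := nondegenerate_near omega m0 exm.
move: nd; rewrite near_withinE.
apply: filterS2 (csphere_near_close (cY j omega) Yj ltr01) => t [y yE _] nd.
rewrite /branch_value yE /=; have [tw|tw] := eqVneq t omega.
  by move: yE; rewrite tw Yj => -[<-]; exact: simple_branch_root.
have /eqP : (genpoly A B t).[y] = 0.
  rewrite (rootsY t (nd tw)) hornerZ horner_prod (bigD1 j) //= yE /=.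
  by rewrite hornerXsubC subrr mul0r mulr0.
rewrite genpolyE PQ !hornerM mulf_eq0 => /orP[/eqP //|].
rewrite horner_exp hornerXsubC -polyCB -polyC_exp hornerC expf_eq0 subr_eq0.
by rewrite eq_complex /= (negbTE tw) !andbF.
Qed.

Lemma branch_value_cvg (e : R) : 0 < e -> \forall t \near omega,
  Y j t = Some (branch_value t) /\ normc (branch_value t - y0) < e.
Proof.
have [_ cY _] := hY => e0.
apply: filterS (csphere_near_close (cY j omega) Yj e0) => t [y yE ye].
by rewrite /branch_value yE.
Qed.

(** The branch is already known to be continuous and to solve [Q = 0], so strict differentiability
    of [Q] and [implicit_bound] yield its derivative directly. *)
Lemma branch_value_derivative d1 d2 :
  sdiff (fun p => Q.[p.1%:P].[p.2]) (0 +i* omega, y0) d1 d2 ->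
  forall e, 0 < e -> \forall t \near omega,
    normc (branch_value t - y0 + d1 / d2 * (0 +i* (t - omega))) <= e * `|t - omega|.
Proof.
move=> hQ e e0; have d20 := simple_branch_derivative hQ.
have [e' e'0 He] := implicit_bound d1 d20 e0.
have [r [r0 Hr]] : exists r : R, 0 < r /\ forall p q,
    pnorm (p - (0 +i* omega, y0)) < r -> pnorm (q - (0 +i* omega, y0)) < r ->
    normc (Q.[p.1%:P].[p.2] - Q.[q.1%:P].[q.2] - (d1 * (p - q).1 + d2 * (p - q).2)) <=
    e' * pnorm (p - q).
  near (0 : R)^'+ => r; exists r; split => //.
  by exact: (near (hQ _ e'0) r).
have r2 : 0 < r / 2 by rewrite divr_gt0.
have near_om : \forall t \near omega, `|t - omega| < r / 2.
  by apply/nbhs_ballP; exists (r / 2) => // t; rewrite /ball /= distrC.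
near=> t.
have [_ yt] : Y j t = Some (branch_value t) /\ normc (branch_value t - y0) < r / 2.
  by exact: (near (branch_value_cvg r2) t).
have qt : Q.[(0 +i* t)%:P].[branch_value t] = 0 by exact: (near branch_value_root t).
have tr : `|t - omega| < r / 2 by exact: (near near_om t).
have itE : 0 +i* t - 0 +i* omega = 0 +i* (t - omega) by simpc.
have nt : normc (0 +i* (t - omega)) = `|t - omega|.
  by rewrite /= expr0n add0r sqrtr_sqr.
have := Hr (0 +i* t, branch_value t) (0 +i* omega, y0).
rewrite !pnorm_pair itE nt !subrr !normc0 addr0 => /(_ _ r0).
rewrite -/q0 /= qt simple_branch_root subr0 sub0r normcN itE -nt => h.
by apply: He; apply: h; rewrite nt; lra.
Unshelve. all: by end_near. Qed.

End BranchesThroughPoint.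

(** * Periodicity, values of modulus 1 and the delay factor *)

Section Preliminaries.
Context {R : realType}.

Lemma cos_eq1_nat (s : R) : - pi < s -> cos s = 1 ->
  exists k : nat, s = 2 * pi * k%:R.
Proof.
move=> spi cs; have pi0 := pi_gt0 R.
have x0 : 0 <= (s + pi) / (2 * pi).
  by rewrite divr_ge0 ?mulr_ge0 ?pi_ge0 //; lra.
(* Subtracting [k] periods moves [s] into [[-pi, pi)], where cosine determines the absolute value;
   the lower bound on [s] makes [k] a natural number. *)
have := Num.Theory.truncn_itv x0; set k := Num.truncn _ => /andP[k1 k2].
rewrite ler_pdivlMr ?mulr_gt0 // in k1.
rewrite ltr_pdivrMr ?mulr_gt0 // -natr1 in k2.
exists k; pose u := s - 2 * pi * k%:R.
have cu : cos `|u| = cos 0.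
  have -> : cos `|u| = cos u by case: (ger0P u) => _; rewrite ?cosN.
  rewrite -(periodicn (@cosD2pi R) k) cos0 -[RHS]cs; congr (cos _).
  by rewrite /u -(mulr_natr _ k) -(mulr_natr pi 2); ring.
have u0 : `|u| = 0.
  apply: cos_inj cu; rewrite in_itv /= ?lexx ?pi_ge0 // normr_ge0 ler_norml.
  by apply/andP; split; rewrite /u; lra.
by move/eqP: u0; rewrite normr_eq0 subr_eq0 => /eqP.
Qed.

Lemma cexp_eq_cos (a b : R) : cexp (0 +i* a) = cexp (0 +i* b) -> cos (a - b) = 1.
Proof.
rewrite /cexp /= expR0 !mul1r => -[ca sa].
by rewrite cosB ca sa -!expr2 cos2Dsin2.
Qed.

Lemma cexp_imag_period (x : R) (k : nat) :
  cexp (0 +i* (x - 2 * pi * k%:R)) = cexp (0 +i* x).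
Proof.
have E : x = x - 2 * pi * k%:R + pi *+ 2 *+ k.
  by rewrite -(mulr_natr _ k) -(mulr_natr pi 2); ring.
by rewrite /cexp /= [in RHS]E (periodicn (@cosD2pi R)) (periodicn (@sinD2pi R)).
Qed.

Lemma gam_eq0 (z : csphere R) : gam z = 0%E <->
  exists2 y : R[i], z = Some y & normc y = 1.
Proof.
split=> [|[y -> ny]]; last by rewrite /gam ny lne1 oppe0.
case: z => [y|//] /= H; exists y => //; move: H.
case: ifPn => // ny /eqP; rewrite -EFinN eqe oppr_eq0 ln_eq0 ?ltNge //.
by move=> /eqP.
Qed.

Lemma sdiff_delay (a : R[i] * R[i]) :
  sdiff (fun p => cexp (- (p.1 * p.2))) a
    (- (a.2 * cexp (- (a.1 * a.2)))) (- (a.1 * cexp (- (a.1 * a.2)))).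
Proof.
have h1 := sdiff_mul (sdiff_cst (-1) a) (sdiff_mul (sdiff_fst a) (sdiff_snd a)).
have h := sdiff_comp (sdiff_cexp (-1 * (a.1 * a.2), 0)) h1 (sdiff_cst 0 a).
move: h; rewrite /= !(mul0r, mulr0, addr0, add0r, mul1r, mulr1, mulN1r) !mulrN.
rewrite ![cexp _ * _]mulrC; apply: eq_sdiff => p /=; by rewrite mulN1r.
Qed.

End Preliminaries.

(** * Elementary properties of characteristic roots *)

Section CharacteristicRoots.
Context {R : realType} {n : nat}.
Implicit Types (A B : 'M[R]_n).

Lemma char_rootE A B t l :
  char_root A B t l <-> (charpoly2 A B).[l%:P].[cexp (- (l * t%:C))] = 0.
Proof. by rewrite charpoly2_horner. Qed.

Lemma conjc_cexp (z : R[i]) : cexp z^* = (cexp z)^*.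
Proof. by case: z => x y; rewrite /cexp /= cosN sinN mulrN. Qed.

(** The matrices and the delay are real, so conjugation commutes with the determinant. This supplies
    the second member of each pair in [root_family]. *)
Lemma char_root_conj A B t l : char_root A B t l -> char_root A B t l^*.
Proof.
rewrite /char_root => H; rewrite -[RHS]conjc0 -[in RHS]H -[RHS]det_map_mx.
congr (\det _); apply/matrixP => i j; rewrite !mxE /=.
have -> : - (l^* * t%:C) = (- (l * t%:C))^*.
  by case: (l) => x y; simpc.
by rewrite conjc_cexp !rmorphB !rmorphM rmorphMn /= !oppr0.
Qed.

Lemma char_root0 A B t : char_root A B t 0 <-> \det (A + B) = 0.
Proof.
rewrite /char_root mul0r oppr0 cexp0 scale1r.
rewrite (_ : _ - _ = cmx (- (A + B))); last first.
  apply/matrixP => i j; rewrite !mxE mul0rn sub0r.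
  by rewrite !rmorphN rmorphD /= opprD.
rewrite det_map_mx -scaleN1r detZ; split=> [/eqP|->].
  by rewrite fmorph_eq0 mulf_eq0 signr_eq0 => /eqP.
by rewrite mulr0 rmorph0.
Qed.

End CharacteristicRoots.

(** * Crossings *)

Section Crossings.
Context {R : realType}.

Lemma near_radius (x : R) (P : R -> Prop) : (\forall t \near x, P t) ->
  \forall r \near 0^'+, forall t, `|t - x| < r -> P t.
Proof.
move=> /nbhs_ballP[d /= d0 H]; near=> r => t tr; apply: H.
rewrite /ball /= distrC (lt_trans tr) //.
Unshelve. all: by end_near. Qed.

Lemma radius_near (x : R) (P : R -> Prop) :
  (\forall r \near 0^'+, forall t, `|t - x| < r -> P t) -> \forall t \near x, P t.
Proof.
move=> H; near (0 : R)^'+ => r; apply/nbhs_ballP; exists r => //= t.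
by rewrite /ball /= distrC; apply: (near H r).
Unshelve. all: by end_near. Qed.

(** A positive derivative would make [f] negative just to the left of its zero. *)
Lemma is_derive_le0 (f : R -> R) (x d : R) : is_derive x 1 f d -> f x = 0 ->
  (\forall t \near x, t < x -> 0 <= f t) -> d <= 0.
Proof.
move=> /is_derive_bound df fx H; rewrite leNgt; apply/negP => d0.
have d2 : 0 < d / 2 by rewrite divr_gt0.
near (0 : R)^'+ => r; have r0 : 0 < r by [].
pose t := x - r / 2.
have tx : `|t - x| = r / 2 by rewrite /t addrAC subrr sub0r normrN gtr0_norm // divr_gt0.
have tr : `|t - x| < r by rewrite tx; lra.
have ft : 0 <= f t.
  have : forall t, `|t - x| < r -> t < x -> 0 <= f t by exact: (near (near_radius H) r).
  by apply => //; rewrite /t; lra.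
have : `|f t - f x - d * (t - x)| <= d / 2 * `|t - x|.
  by apply: (near (df _ d2) r).
rewrite tx fx subr0 (_ : t - x = - (r / 2)); last by rewrite /t; ring.
have dr : 0 < d * r by rewrite mulr_gt0.
by rewrite ler_norml => /andP[_]; lra.
Unshelve. all: by end_near. Qed.

Context {n : nat} (A B : 'M[R]_n) {m : nat} (Y : 'I_m -> R -> csphere R).
Variables (omega : R) (Q : {poly {poly R[i]}}) (s : nat) (y0 : R[i]) (j : 'I_m).
Variables (d1 d2 : R[i]).
Hypotheses (hY : acs_roots A B Y) (m0 : (0 < m)%N).
Hypothesis PQ : charpoly2 A B = Q * ('X - (0 +i* omega)%:P%:P) ^+ s.
Hypothesis Q0 : Q.[(0 +i* omega)%:P] != 0.
Hypotheses (Yj : Y j omega = Some y0) (Yk : forall k, Y k omega = Some y0 -> k = j).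
Hypothesis hQ : sdiff (fun p => Q.[p.1%:P].[p.2]) (0 +i* omega, y0) d1 d2.
Hypothesis ny0 : normc y0 = 1.

(* Y_j' = - i d1 / d2 at omega, by implicit differentiation. *)
Lemma is_derive_gam : is_derive omega 1 (fun t => fine (gam (Y j t)))
  (- Im (d1 / d2 / y0)).
Proof.
pose y := branch_value Y j; have y0E : y omega = y0 by rewrite /y /branch_value Yj.
have dy := branch_value_derivative hY m0 PQ Q0 Yj Yk hQ.
pose k := d1 / d2.
(* The real and imaginary parts of [- i k] are [Im k] and [- Re k]. *)
have du : is_derive omega 1 (fun t => Re (y t)) (Im k).
  apply/is_derive_bound => e /dy/near_radius; apply: filterS => r H t /H.
  apply: le_trans; apply: le_trans (le_Re_normc _); rewrite y0E -/k -/y.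
  case: (y t) (y0) (k) => [? ?] [? ?] [? ?] /=; rewrite le_eqVlt.
  by apply/orP; left; apply/eqP; congr `|_|; ring.
have dv : is_derive omega 1 (fun t => Im (y t)) (- Re k).
  apply/is_derive_bound => e /dy/near_radius; apply: filterS => r H t /H.
  apply: le_trans; apply: le_trans (le_Im_normc _); rewrite y0E -/k -/y.
  case: (y t) (y0) (k) => [? ?] [? ?] [? ?] /=; rewrite le_eqVlt.
  by apply/orP; left; apply/eqP; congr `|_|; ring.
have N1 : Re y0 ^+ 2 + Im y0 ^+ 2 = 1 by rewrite -normc_sqr ny0 expr1n.
pose f t : R := - (2^-1 * ln (Re (y t) ^+ 2 + Im (y t) ^+ 2)).
have df : is_derive omega 1 f (- (Re y0 * Im k - Im y0 * Re k)).
  pose g t : R := Re (y t) ^+ 2 + Im (y t) ^+ 2.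
  have dg : is_derive omega 1 g (2 * (Re y0 * Im k - Im y0 * Re k)).
    have d2' := is_deriveD (is_deriveX 2 du) (is_deriveX 2 dv).
    apply: (@is_derive_eq _ _ _ _ _ _ _ _ d2').
    by rewrite /GRing.scale /= y0E !expr1; ring.
  have dl : is_derive (g omega) 1 (@ln R) 1.
    by rewrite /g y0E N1 -[X in is_derive _ _ _ X]invr1; exact: is_derive1_ln.
  have df := is_deriveN (is_deriveZ 2^-1 (is_derive1_comp dl dg)).
  apply: (@is_derive_eq _ _ _ _ _ _ _ _ df).
  by rewrite /GRing.scale /=; field.
have -> : - Im (d1 / d2 / y0) = - (Re y0 * Im k - Im y0 * Re k).
  rewrite -/k; case: (y0) N1 (k) => [a b] /= N1 [c d] /=; rewrite N1.
  by rewrite !invr1; ring.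
apply: near_eq_is_derive df.
(* Within 1/2 of the unimodular [y0] the branch is finite and nonzero, so [gam] is finite there and
   equals [f]. *)
have h1 : 0 < 1 / 2 :> R by rewrite divr_gt0.
apply: filterS (branch_value_cvg hY Yj h1) => t [-> yt]; rewrite -/y in yt *.
have yt0 : 0 < normc (y t).
  by have := le_normcB y0 (y t); rewrite ny0 (normcB y0); lra.
by rewrite /f -normc_sqr lnXn // /gam lne_EFin //= -mulr_natl; field.
Qed.

(** The implicit function theorem is applied to [Q] along the delay factor rather than to the
    determinant, which may contain further powers of [l - i omega]. Since [tau] is real and [Im w]
    is positive, [w - tau] cannot vanish. *)
Lemma destabilizing_crossing_of_branch (tau : R) : 0 < omega ->
  cexp (- ((0 +i* omega) * tau%:C)) = y0 -> 0 < Im (d1 / d2 / y0) ->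
  destabilizing_crossing A B tau omega.
Proof.
move=> om0 ey0 imw; pose a := (0 +i* omega, tau%:C) : R[i] * R[i].
have d20 := simple_branch_derivative hY m0 PQ Q0 Yj Yk hQ.
have y00 : y0 != 0 by rewrite -normc_eq0 ny0 oner_eq0.
set w := d1 / d2 / y0 in imw.
pose G p := Q.[p.1%:P].[cexp (- (p.1 * p.2))].
have hG : sdiff G a (d2 * y0 * (w - tau%:C)) (- (d2 * y0 * (0 +i* omega))).
  have hQ' : sdiff (fun p => Q.[p.1%:P].[p.2]) (a.1, cexp (- (a.1 * a.2))) d1 d2.
    by rewrite /= ey0.
  have := sdiff_comp hQ' (sdiff_fst a) (sdiff_delay a).
  rewrite /= ey0 mulr1 mulr0 add0r => h.
  have -> : d2 * y0 * (w - tau%:C) = d1 + d2 * - (tau%:C * y0).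
    by rewrite /w; field; apply/andP.
  by have -> : - (d2 * y0 * (0 +i* omega)) = d2 * - ((0 +i* omega) * y0) by ring.
have G0 : G a = 0 by rewrite /G /= ey0 (simple_branch_root hY m0 PQ Yj Yk).
have imwt : Im (w - tau%:C) = Im w by case: (w) => x y; simpc.
have wt : w - tau%:C != 0.
  by apply: contraTneq imw => wt; rewrite -imwt wt ltxx.
have D1 : d2 * y0 * (w - tau%:C) != 0 by rewrite !mulf_neq0.
have [phi [r [C [r0 phib Gphi lip dphi]]]] := implicit_function hG G0 D1.
pose l t := phi t%:C.
have cs (t t' : R) : normc (t%:C - t'%:C) = `|t - t'|.
  by rewrite (_ : _ - _ = (t - t')%:C); [rewrite normcR|rewrite rmorphB].
have near_r : \forall t \near tau, `|t - tau| < r.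
  by apply/nbhs_ballP; exists r => // t; rewrite /ball /= distrC.
have l_root t : `|t - tau| < r -> char_root A B t (l t).
  move=> tr; apply/char_rootE; rewrite PQ !hornerM.
  by have := Gphi t%:C; rewrite cs /G /= => -> //; rewrite mul0r.
have cl t : `|t - tau| < r -> forall e : R, 0 < e ->
    \forall t' \near t, normc (l t' - l t) < e.
  move=> tr e e0; have tr' : 0 < r - `|t - tau| by rewrite subr_gt0.
  (* The Lipschitz constant [C] comes without a sign, hence the absolute value and the added 1. *)
  have C0 : 0 < `|C| + 1 by rewrite ltr_wpDl.
  have eC : 0 < e / (`|C| + 1) by rewrite divr_gt0.
  apply: radius_near; near=> d => t' td.
  have dr : d < r - `|t - tau| by exact: (near (nbhs_right_lt tr') d).
  have dC : d < e / (`|C| + 1) by exact: (near (nbhs_right_lt eC) d).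
  rewrite ltr_pdivlMr // in dC.
  have t'r : `|t' - tau| < r.
    by have := ler_normD (t' - t) (t - tau); rewrite addrA subrK; lra.
  have := lip t'%:C t%:C; rewrite !cs => /(_ t'r tr) /le_lt_trans; apply.
  apply: le_lt_trans dC; apply: (@le_trans _ _ (`|C| * `|t' - t|)).
    by rewrite ler_wpM2r // ler_norm.
  by rewrite mulrC ler_pM ?(ltW td) // lerDl.
have da : is_derive tau 1 (fun t => Re (l t)) (Re ((0 +i* omega) / (w - tau%:C))).
  apply/is_derive_bound => e /dphi; apply: filterS => rho H t tr.
  have := H t%:C; rewrite cs => /(_ tr); apply: le_trans; apply: le_trans (le_Re_normc _).
  have -> : - (d2 * y0 * (0 +i* omega)) / (d2 * y0 * (w - tau%:C)) =
     - ((0 +i* omega) / (w - tau%:C)).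
    by field; apply/and3P.
  rewrite /l phib; case: (phi _) (_ / _) => [x y] [x' y'] /=.
  rewrite le_eqVlt; apply/orP; left; apply/eqP; congr `|_|; ring.
exists (fun t => Re (l t)), (fun t => Im (l t)); split; first split => //.
- apply: filterS near_r => t tr; split.
  + by have := l_root t tr; case: (l t).
  + by have := char_root_conj (l_root t tr); case: (l t).
  + apply/cvgrPdist_lt => e /(cl t tr); apply: filterS => t'.
    apply: le_lt_trans; rewrite normcB; apply: le_trans (le_Re_normc _).
    by case: (l t) (l t') => [? ?] [? ?] /=.
  + apply/cvgrPdist_lt => e /(cl t tr); apply: filterS => t'.
    apply: le_lt_trans; rewrite normcB; apply: le_trans (le_Im_normc _).
    by case: (l t) (l t') => [? ?] [? ?] /=.
- by rewrite /l phib.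
- by rewrite /l phib.
rewrite derive1E; case: (da) => _ ->.
move: imw; rewrite -imwt; case: (w - tau%:C) => x y /= y0'.
have xy : 0 < x ^+ 2 + y ^+ 2 by rewrite ltr_wpDl ?sqr_ge0 // exprn_gt0.
have -> : 0 * (x / (x ^+ 2 + y ^+ 2)) - omega * - (y / (x ^+ 2 + y ^+ 2)) =
  omega * y / (x ^+ 2 + y ^+ 2) by field; rewrite gt_eqF.
by rewrite divr_gt0 // mulr_gt0.
Unshelve. all: by end_near. Qed.

End Crossings.

(** * The equation satisfied at a transverse crossing *)

Section Necessity.
Context {R : realType} {n : nat} (A B : 'M[R]_n).

(* For t near tau, t <> tau, the crossing root l(t) is off the imaginary axis,
   hence is not i omega and is a root of the factor Q; then let t -> tau. *)
Lemma transverse_crossing_root (tau omega : R) (Q : {poly {poly R[i]}}) s :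
  charpoly2 A B = Q * ('X - (0 +i* omega)%:P%:P) ^+ s ->
  transverse_crossing A B tau omega ->
  Q.[(0 +i* omega)%:P].[cexp (- ((0 +i* omega) * tau%:C))] = 0.
Proof.
move=> PQ [alpha [mu [[om0 fam a0 mu0 da] da0]]].
have dal : is_derive tau 1 alpha (derive1 alpha tau) by rewrite derive1E; exact: derivableP.
pose a := (0 +i* omega, tau%:C) : R[i] * R[i].
have [d1 [d2 hQ]] := sdiff_poly2 Q (a.1, cexp (- (a.1 * a.2))).
have hG := sdiff_comp hQ (sdiff_fst a) (sdiff_delay a).
pose c t : R[i] * R[i] := (alpha t +i* mu t, t%:C).
have cc e : 0 < e -> \forall t \near tau^', pnorm (c t - a) < e.
  move=> e0; have e3 : 0 < e / 3 by rewrite divr_gt0.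
  have [_ _ /cvgrPdistC_lt/(_ _ e3) ca /cvgrPdistC_lt/(_ _ e3) cm] := nbhs_singleton fam.
  have ct : \forall t \near tau, `|t - tau| < e / 3.
    by apply/nbhs_ballP; exists (e / 3) => // t; rewrite /ball /= distrC.
  apply: nbhs_dnbhs; near=> t.
  have h1 : `|alpha t - alpha tau| < e / 3 by exact: (near ca t).
  have h2 : `|mu t - mu tau| < e / 3 by exact: (near cm t).
  have h3 : `|t - tau| < e / 3 by exact: (near ct t).
  have nt : normc (t%:C - tau%:C) = `|t - tau| by rewrite -normcR rmorphB.
  rewrite pnorm_pair nt.
  have := normc_le_ReIm ((alpha t +i* mu t) - (0 +i* omega)).
  rewrite !raddfB /= -a0 -mu0; lra.
have G0 : \forall t \near tau^', Q.[(c t).1%:P].[cexp (- ((c t).1 * (c t).2))] = 0.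
  (* With half the slope as tolerance, [alpha t = 0] is impossible for [t != tau], so the power of
     [l - i omega] does not vanish at the crossing root. *)
  have d2' : 0 < `|derive1 alpha tau| / 2 by rewrite divr_gt0 // normr_gt0.
  have /is_derive_bound/(_ _ d2')/radius_near ha := dal.
  rewrite near_withinE; near=> t => tt.
  have : `|alpha t - alpha tau - derive1 alpha tau * (t - tau)| <=
      `|derive1 alpha tau| / 2 * `|t - tau| by exact: (near ha t).
  have [+ _ _ _] : [/\ char_root A B t (alpha t +i* mu t),
      char_root A B t (alpha t -i* mu t),
      {for t, continuous alpha} & {for t, continuous mu}] by exact: (near fam t).
  move=> /char_rootE; rewrite PQ !hornerM => /eqP.
  rewrite mulf_eq0 => /orP[/eqP //|].
  rewrite horner_exp hornerXsubC -polyCB -polyC_exp hornerC expf_eq0 subr_eq0.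
  rewrite eq_complex /= => /and3P[_ /eqP -> _].
  rewrite a0 subrr sub0r normrN normrM.
  have tt0 : 0 < `|t - tau| by rewrite normr_gt0 subr_eq0.
  rewrite ler_pM2r // => h.
  by exfalso; move: da0; rewrite -normr_gt0; lra.
have lim := sdiff_near hG cc.
apply/eqP; rewrite -normc_eq0 eq_le normc_ge0 andbT; apply/ler_addgt0Pl => e /lim He.
near (tau^') => t.
rewrite addr0 ltW //.
have : Q.[(c t).1%:P].[cexp (- ((c t).1 * (c t).2))] = 0 by exact: (near G0 t).
have : normc (Q.[(c t).1%:P].[cexp (- ((c t).1 * (c t).2))] -
   Q.[a.1%:P].[cexp (- (a.1 * a.2))]) < e by exact: (near He t).
by move=> /[swap] ->; rewrite sub0r normcN.
Unshelve. all: by end_near. Qed.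

End Necessity.

(** The determinant is monic in [l], hence nonzero, so [l - i omega] divides it only finitely
    often. *)
Lemma charpoly2_factor (R : realType) (n : nat) (A B : 'M[R]_n) (omega : R) :
  exists (Q : {poly {poly R[i]}}) s, Q.[(0 +i* omega)%:P] != 0 /\
    charpoly2 A B = Q * ('X - (0 +i* omega)%:P%:P) ^+ s.
Proof.
have [s [Q]] := multiplicity_XsubC (charpoly2 A B) (0 +i* omega)%:P.
by rewrite charpoly2_neq0 /= => Q0 PQ; exists Q, s.
Qed.

(* The branch gamma_j may have a zero of odd order > 1 at omegaH, and then the
   crossing there has d alpha / d tau = 0; hence the premise gamma_j' <> 0. *)
Theorem corollary6p1 (R : realType) (n : nat) (A B : 'M[R]_n)
    (m : nat) (Y : 'I_m -> R -> csphere R) (j : 'I_m) (omegaH : R)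
    (hY : acs_roots A B Y) (hIII : class_III Y j omegaH) :
  let tauH := tau_ (phi_H Y j omegaH) omegaH in
  [/\ (forall tau : R, 0 < tau -> char_root A B tau 0) <-> \det (A + B) = 0,
      derive1 (fun omega : R => fine (gam (Y j omega))) omegaH != 0 ->
        forall k : nat, destabilizing_crossing A B (tauH k) omegaH &
      forall tau omega : R, 0 < tau -> transverse_crossing A B tau omega ->
        omega = omegaH /\ exists k : nat, tau = tauH k].
Proof.
move=> tauH; have [om0 [_ gH _] gpos gneg gother] := hIII.
have m0 : (0 < m)%N by case: (m) (j) => [[]|].
have /gam_eq0[y0 Yj ny0] := gH.
have y00 : y0 != 0 by rewrite -normc_eq0 ny0 oner_eq0.
have [/andP[carg_gt _] y0E] := cargP y00.
rewrite ny0 mul1r in y0E.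
have tauE k : omegaH * tauH k = 2 * pi * k%:R - carg y0.
  by rewrite /tauH /tau_ /phi_H Yj /=; field; rewrite gt_eqF.
have itE (w t : R) : - ((0 +i* w) * t%:C) = 0 +i* - (w * t) by simpc.
(* Another branch through the unimodular [y0] would have a zero of its own [gam]. *)
have Yk k : Y k omegaH = Some y0 -> k = j.
  move=> Yk; apply/eqP; apply: contraT => /gother/(_ omegaH)[].
  by apply/gam_eq0; exists y0.
split.
- split=> [H|dAB t _]; last exact/char_root0.
  exact/(char_root0 _ _ 1)/H.
- move=> dgam k; have [Q [s [Q0 PQ]]] := charpoly2_factor A B omegaH.
  have [d1 [d2 hQ]] := sdiff_poly2 Q (0 +i* omegaH, y0).
  have dg := is_derive_gam hY m0 PQ Q0 Yj Yk hQ ny0.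
  apply: (destabilizing_crossing_of_branch hY m0 PQ Q0 Yj Yk hQ ny0 om0).
    by rewrite itE tauE opprB cexp_imag_period.
  move: dgam; rewrite derive1E; case: (dg) => _ -> dgam.
  (* The premise excludes a zero slope, and positivity of the branch on [(0, omegaH)] excludes a
     positive one. *)
  rewrite -oppr_lt0 lt_neqAle dgam /=.
  apply: (is_derive_le0 dg); first by rewrite gH.
  have near0 : \forall t \near omegaH, `|t - omegaH| < omegaH.
    by apply/nbhs_ballP; exists omegaH => // t; rewrite /ball /= distrC.
  apply: filterS near0 => t; rewrite ltr_norml => /andP[t1 t2] tH.
  (* Where [gam] is infinite, [fine] returns 0, which is still nonnegative. *)
  apply: fine_ge0; apply/ltW/gpos; last by apply/eqP; lra.
  by apply/andP; split; lra.
- move=> tau omega tau0 crossing.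
  have [Q [s [Q0 PQ]]] := charpoly2_factor A B omega.
  have qy := transverse_crossing_root PQ crossing.
  have [k Yk1] := root_on_branch hY m0 PQ Q0 qy.
  have om1 : 0 < omega by case: crossing => ? [? [[]]].
  (* The branch value is the exponential of an imaginary number, so it has modulus 1. *)
  have gk : gam (Y k omega) = 0%E.
    by apply/gam_eq0; eexists; [exact: Yk1|rewrite itE normc_cexp /= expR0].
  have kj : k = j by apply/eqP; apply: contraT => /gother/(_ omega).
  rewrite {k}kj in Yk1 gk.
  have omE : omega = omegaH.
    have [oo|oo] := boolP (- omegaH <= omega <= omegaH); last first.
      by have := gneg _ oo; rewrite gk ltxx.
    move: oo => /andP[_]; rewrite le_eqVlt => /orP[/eqP //|oo].
    have := gpos omega; rewrite gk ltxx => H; exfalso.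
    suff : false by []; apply: H; last by rewrite gt_eqF.
    by apply/andP; split; lra.
  split => //; rewrite omE Yj itE in Yk1; case: Yk1 => y0c.
  have := cexp_eq_cos (a := carg y0) (b := - (omegaH * tau)).
  rewrite -y0E -y0c => /(_ erefl); rewrite opprK => cs.
  (* The principal argument exceeds [- pi] and [omegaH * tau] is positive, so their sum is a
     natural, not merely an integer, multiple of [2 * pi]. *)
  have [|k kE] := cos_eq1_nat _ cs.
    by have := mulr_gt0 om0 tau0; lra.
  exists k; have := tauE k; rewrite -kE addrAC subrr add0r.
  by move/(mulfI (lt0r_neq0 om0)).
Qed.
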